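(* Let $M=(M_1,\dots,M_n)$, $M_{n+1}=M_1$, be a billiard $n$-gon in an ellipse, circumscribing the confocal ellipse $\gamma$ with semi-axes $b<a$. Let $O$ be the center and $F_1,F_2$ the foci of the ellipse. For a point $X$, let $d_i(X)$ denote the distance from $X$ to the line $M_iM_{i+1}$ (the length of the perpendicular dropped from $X$ to this line). (1) If $n$ is even, then $\prod_{i=1}^n d_i(F_1)$ and $\prod_{i=1}^n d_i(F_2)$ are constant and equal to $b^n$ as $M$ varies in the 1-parameter family of $n$-periodic billiard orbits. (2) If $n$ is divisible by $4$, then $\prod_{i=1}^n d_i(O)$ is constant and equal to $(ab)^{n/2}$ as $M$ varies in the 1-parameter family of $n$-periodic billiard orbits.
   Context: A billiard $n$-gon ($n\ge 3$) in an ellipse $E$ is a closed $n$-periodic billiard trajectory inside $E$ whose (minimal) period is $n$, so that it is not a polygon with fewer sides traversed several times: $M_i\in E$, $M_i\ne M_{i+1}$, and at each $M_i$ the segments $M_{i-1}M_i$ and $M_iM_{i+1}$ obey the law of reflection (equal angles with the tangent line to $E$ at $M_i$). It circumscribes the confocal ellipse $\gamma$ (same foci as $E$, lying inside $E$) if all its sides are tangent to $\gamma$; the polygon may be self-intersecting (star-shaped). By the Poncelet Porism, if one billiard trajectory in $E$ tangent to $\gamma$ closes up after $n$ steps, then so does every billiard trajectory in $E$ tangent to $\gamma$; the 1-parameter family of $n$-periodic billiard orbits consists of all billiard $n$-gons in $E$ circumscribing the same $\gamma$. *)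

(* Defs.v *)
From Stdlib Require Import Reals.
Open Scope R_scope.

(** * Euclidean plane *)

Definition point : Type := (R * R)%type.

Definition vadd (X Y : point) : point := (fst X + fst Y, snd X + snd Y).
Definition vsub (X Y : point) : point := (fst X - fst Y, snd X - snd Y).
Definition vscale (k : R) (X : point) : point := (k * fst X, k * snd X).
Definition vopp (X : point) : point := vscale (-1) X.
Definition dot (X Y : point) : R := fst X * fst Y + snd X * snd Y.
Definition norm (X : point) : R := sqrt (dot X X).
Definition rot90 (X : point) : point := (- snd X, fst X).
Definition zero : point := (0, 0).

(** Unoriented angle, in [[0, PI]], between two nonzero vectors. *)
Definition angle (v w : point) : R := acos (dot v w / (norm v * norm w)).

(** Foot of the perpendicular dropped from [X] to the line [AB] (for [A <> B]). *)
Definition foot (X A B : point) : point :=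
  let u := vsub B A in
  vadd A (vscale (dot (vsub X A) u / dot u u) u).

Definition dist_to_line (X A B : point) : R := norm (vsub X (foot X A B)).

Definition on_line (X A B : point) : Prop :=
  exists s : R, X = vadd A (vscale s (vsub B A)).

(** * Ellipses in arbitrary position *)

(** [axis] is a unit vector along the major axis. *)
Record ellipse : Type := Ellipse {
  center : point;
  axis : point;
  semi_major : R;
  semi_minor : R;
  axis_unit : norm axis = 1;
  semi_minor_pos : 0 < semi_minor;
  semi_minor_le_major : semi_minor <= semi_major
}.

Definition ellipse_form (e : ellipse) (X : point) : R :=
  (dot (vsub X (center e)) (axis e) / semi_major e) ^ 2 +
  (dot (vsub X (center e)) (rot90 (axis e)) / semi_minor e) ^ 2.

Definition on_ellipse (e : ellipse) (X : point) : Prop := ellipse_form e X = 1.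
Definition inside_ellipse (e : ellipse) (X : point) : Prop := ellipse_form e X < 1.

Definition focal_dist (e : ellipse) : R :=
  sqrt (semi_major e ^ 2 - semi_minor e ^ 2).
Definition focus1 (e : ellipse) : point :=
  vadd (center e) (vscale (focal_dist e) (axis e)).
Definition focus2 (e : ellipse) : point :=
  vsub (center e) (vscale (focal_dist e) (axis e)).

(** Equality of the unordered pairs of foci: the axis vectors of the two
    ellipses may be opposite. *)
Definition confocal (e e' : ellipse) : Prop :=
  (focus1 e = focus1 e' /\ focus2 e = focus2 e') \/
  (focus1 e = focus2 e' /\ focus2 e = focus1 e').

Definition lies_inside (e e' : ellipse) : Prop :=
  forall X : point, on_ellipse e X -> inside_ellipse e' X.

(** [t] directs the tangent line to [e] at the point [P] of [e]; the ellipse is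
    a regular level set of [ellipse_form e], so its tangent directions are
    those along which the derivative vanishes. *)
Definition tangent_dir (e : ellipse) (P t : point) : Prop :=
  t <> zero /\
  derivable_pt_lim (fun s : R => ellipse_form e (vadd P (vscale s t))) 0 0.

Definition line_tangent (e : ellipse) (A B : point) : Prop :=
  exists P : point,
    on_ellipse e P /\ on_line P A B /\ tangent_dir e P (vsub B A).

(** * Billiards *)

(** Segments [AP] and [PB] make equal angles with opposite rays of the tangent
    line at [P].  (Comparing unoriented angles with the line itself would
    wrongly accept [B = A] at every incidence.) *)
Definition reflects (e : ellipse) (A P B : point) : Prop :=
  forall t : point, tangent_dir e P t ->
    angle (vsub A P) t = angle (vsub B P) (vopp t).

(** The vertices [M_1, ..., M_n] are [M 0, ..., M (n-1)], extended to an
    [n]-periodic sequence. *)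
Definition billiard_ngon (e : ellipse) (n : nat) (M : nat -> point) : Prop :=
  (forall i : nat, on_ellipse e (M i)) /\
  (forall i : nat, M i <> M (S i)) /\
  (forall i : nat, reflects e (M i) (M (S i)) (M (S (S i)))) /\
  (forall i : nat, M (i + n)%nat = M i) /\
  (forall m : nat, (0 < m < n)%nat -> ~ (forall i : nat, M (i + m)%nat = M i)).

Definition circumscribes (M : nat -> point) (e : ellipse) : Prop :=
  forall i : nat, line_tangent e (M i) (M (S i)).

Definition side_dist (M : nat -> point) (X : point) (i : nat) : R :=
  dist_to_line X (M i) (M (S i)).

(** [prod_f_R0 f N] is the product of [f 0, ..., f N], hence the [n - 1];
    meaningful for [1 <= n]. *)
Definition side_dist_prod (n : nat) (M : nat -> point) (X : point) : R :=
  prod_f_R0 (side_dist M X) (n - 1).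

(* Main.v *)
Require Import Defs.
From Stdlib Require Import Reals PeanoNat.
From Stdlib Require Import Lia Lra Psatz IndefiniteDescription.
Open Scope R_scope.

(** A side of the polygon is tangent to the inner ellipse [gamma], so it is
    given by the eccentric angle of its point of contact.  In coordinates where
    [gamma] is the unit circle and the outer ellipse is the conic
    [K X^2 + L Y^2 = 1], two consecutive sides are tangents of the circle that
    meet on the conic; choosing the forward neighbor defines a step on angles,
    which is increasing and single-valued ([step_lt], [step_unique]).  The law
    of reflection guarantees that a trajectory never runs back along a side
    ([no_backtrack]), so the angles of its sides form an orbit of this step,
    turning always in the same direction ([poncelet_orbit]).

    The products are computed by pairing sides.  The pairing comes from an order
    argument ([orbit_sqrt]) that replaces elliptic functions: if an increasing
    map [S] commutes with the step and [S o S] agrees with [2m] steps along an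
    orbit, then [S] agrees with [m] steps.

    For [n = 2m], the orbit advances by [2 k PI] in [n] steps.  Translation by
    [k PI] commutes with the step, so [m] steps are the translation by [k PI]
    ([orbit_half]); minimality of the period makes [k] odd, hence sides [i] and
    [i + m] are centrally symmetric ([billiard_symmetries]).  Distances from one
    focus to two opposite tangents are the distances from both foci to one
    tangent, whose product is [b^2] ([focal_dist_pair]).

    For [n = 4l], translation by an odd multiple of [PI] has a square root built
    from the map [quarter], the lift of the linear map
    [(c, s) -> (- a s, b c)] acting on directions.  It commutes with the step
    because the two ellipses are confocal ([step_quarter]); hence [l] steps act
    as this square root ([orbit_quarter]).  The distances from the center to the
    tangents at [x] and at [quarter x] have product [a b]
    ([tangent_norm_quarter]). *)

(** * The step between consecutive sides and its monotonicity *)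

(** For eccentric angles [x], [y] with mean [p] and half-difference [q], the
    tangents to the unit circle at [x] and [y] meet at
    [(cos p / cos q, sin p / cos q)].  This point lies on the conic
    [K X^2 + L Y^2 = 1] exactly when the form vanishes, and inside it when the
    form is negative; clearing the denominator keeps the form total. *)
Definition chord_form (K L x y : R) : R :=
  K * cos ((x + y) / 2) ^ 2 + L * sin ((x + y) / 2) ^ 2 - cos ((y - x) / 2) ^ 2.

Definition step (K L x y : R) : Prop :=
  x < y < x + PI /\ chord_form K L x y = 0.

Lemma sin_sq_cos_sq x : sin x ^ 2 = 1 - cos x ^ 2.
Proof. pose proof (sin2_cos2 x) as H; unfold Rsqr in H; lra. Qed.

(** Being bilinear in the two unit vectors, the relation is visibly preserved
    when both of them change sign. *)
Lemma chord_form_bilinear K L x y :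
  2 * chord_form K L x y =
  K + L - 1 - ((1 + L - K) * (cos x * cos y) + (1 + K - L) * (sin x * sin y)).
Proof.
  unfold chord_form.
  set (p := (x + y) / 2); set (q := (y - x) / 2).
  replace x with (p - q) by (unfold p, q; field).
  replace y with (p + q) by (unfold p, q; field).
  rewrite cos_minus, cos_plus, sin_minus, sin_plus.
  pose proof (sin_sq_cos_sq p); pose proof (sin_sq_cos_sq q).
  replace ((cos p * cos q + sin p * sin q) * (cos p * cos q - sin p * sin q))
    with (cos p ^ 2 * cos q ^ 2 - sin p ^ 2 * sin q ^ 2) by ring.
  replace ((sin p * cos q - cos p * sin q) * (sin p * cos q + cos p * sin q))
    with (sin p ^ 2 * cos q ^ 2 - cos p ^ 2 * sin q ^ 2) by ring.
  rewrite H, H0; ring.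
Qed.

(** On the tangent at [x], the point at signed distance [t = tan d] from the
    point of contact is [(cos x - t sin x, sin x + t cos x)]: the form becomes a
    quadratic in [t]. *)
Lemma chord_form_tan K L x d :
  cos d <> 0 ->
  chord_form K L x (x + 2 * d) =
  cos d ^ 2 * (K * (cos x - tan d * sin x) ^ 2 +
               L * (sin x + tan d * cos x) ^ 2 - 1).
Proof.
  intros Hd; unfold chord_form.
  replace ((x + (x + 2 * d)) / 2) with (x + d) by field.
  replace ((x + 2 * d - x) / 2) with d by field.
  rewrite cos_plus, sin_plus; unfold tan; field; exact Hd.
Qed.

Lemma chord_form_mirror K L x y :
  chord_form K L (- y) (- x) = chord_form K L x y.
Proof.
  unfold chord_form.
  replace ((- y + - x) / 2) with (- ((x + y) / 2)) by field.
  replace ((- x - - y) / 2) with ((y - x) / 2) by field.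
  rewrite cos_neg, sin_neg; ring.
Qed.

Lemma chord_form_opp K L x y : chord_form K L (- x) (- y) = chord_form K L x y.
Proof.
  unfold chord_form.
  replace ((- x + - y) / 2) with (- ((x + y) / 2)) by field.
  replace ((- y - - x) / 2) with (- ((y - x) / 2)) by field.
  rewrite !cos_neg, sin_neg; ring.
Qed.

Section Monotone.
Variables K L : R.
Hypotheses (HK : 0 < K < 1) (HL : 0 < L < 1).

(** The quadratic in [t] is convex and negative at the point of contact
    [t = 0], which is inside the outer conic.  Hence if it is nonpositive at
    some [t > 0], it is negative at every smaller [t >= 0]. *)
Lemma chord_form_shrink_right x y z :
  x < z < y -> y < x + PI -> chord_form K L x y <= 0 -> chord_form K L x z < 0.
Proof.
  intros Hz Hy.
  replace y with (x + 2 * ((y - x) / 2)) by field.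
  replace z with (x + 2 * ((z - x) / 2)) by field.
  set (d := (y - x) / 2); set (d' := (z - x) / 2).
  assert (Hd : 0 < d < PI / 2) by (unfold d; lra).
  assert (Hd' : 0 < d' < d) by (unfold d, d'; lra).
  assert (Hc : 0 < cos d) by (apply cos_gt_0; lra).
  assert (Hc' : 0 < cos d') by (apply cos_gt_0; lra).
  assert (Ht' : 0 < tan d') by (apply tan_gt_0; lra).
  assert (Ht : tan d' < tan d) by (apply tan_increasing; lra).
  rewrite !chord_form_tan by lra.
  set (t := tan d) in *; set (t' := tan d') in *.
  set (c := cos x); set (s := sin x).
  assert (Hcs : s ^ 2 = 1 - c ^ 2) by apply sin_sq_cos_sq.
  intros H.
  assert (H1 : K * (c - t * s) ^ 2 + L * (s + t * c) ^ 2 - 1 <= 0).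
  { assert (0 < cos d ^ 2) by nra. nra. }
  assert (H0 : K * c ^ 2 + L * s ^ 2 - 1 < 0).
  { pose proof (pow2_ge_0 c); pose proof (pow2_ge_0 s).
    destruct (Rle_lt_dec (c ^ 2) (1 / 2)); nra. }
  assert (Ha : 0 <= K * s ^ 2 + L * c ^ 2).
  { pose proof (pow2_ge_0 c); pose proof (pow2_ge_0 s); nra. }
  assert (H2 : t * (K * (c - t' * s) ^ 2 + L * (s + t' * c) ^ 2 - 1) < 0).
  { replace (t * (K * (c - t' * s) ^ 2 + L * (s + t' * c) ^ 2 - 1))
      with (t' * (K * (c - t * s) ^ 2 + L * (s + t * c) ^ 2 - 1)
            + (t - t') * (K * c ^ 2 + L * s ^ 2 - 1)
            - t * t' * (t - t') * (K * s ^ 2 + L * c ^ 2)) by ring.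
    assert (0 <= t * t' * (t - t')) by (apply Rmult_le_pos; nra).
    nra. }
  assert (H3 : K * (c - t' * s) ^ 2 + L * (s + t' * c) ^ 2 - 1 < 0) by nra.
  assert (0 < cos d' ^ 2) by nra.
  nra.
Qed.

Lemma chord_form_shrink_left x y z :
  x < z < y -> y < x + PI -> chord_form K L x y <= 0 -> chord_form K L z y < 0.
Proof.
  intros Hz Hy H.
  rewrite <- chord_form_mirror.
  apply chord_form_shrink_right with (- x); try lra.
  rewrite chord_form_mirror; exact H.
Qed.

(** Otherwise the arc from [y] to [y'] would be strictly nested in the arc from
    [x] to [x'], and the tangents at the ends of the inner arc would meet
    strictly inside the outer conic. *)
Lemma step_lt x y x' y' : step K L x x' -> step K L y y' -> x < y -> x' < y'.
Proof.
  intros [Hx Cx] [Hy Cy] Hxy.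
  destruct (Rlt_le_dec x' y') as [H | H]; [exact H | exfalso].
  assert (H1 : chord_form K L y x' < 0)
    by (apply chord_form_shrink_left with x; lra).
  destruct H as [H | H].
  - assert (chord_form K L y y' < 0)
      by (apply chord_form_shrink_right with x'; lra).
    lra.
  - subst; lra.
Qed.

Lemma step_unique x y y' : step K L x y -> step K L x y' -> y = y'.
Proof.
  intros [Hx Cx] [Hy Cy].
  destruct (Rtotal_order y y') as [H | [H | H]]; [exfalso | exact H | exfalso].
  - assert (chord_form K L x y < 0)
      by (apply chord_form_shrink_right with y'; lra).
    lra.
  - assert (chord_form K L x y' < 0)
      by (apply chord_form_shrink_right with y; lra).
    lra.
Qed.

End Monotone.

Definition orbit (K L : R) (f : nat -> R) : Prop :=
  forall i, step K L (f i) (f (S i)).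

Lemma orbit_lt K L f g i j r :
  0 < K < 1 -> 0 < L < 1 -> orbit K L f -> orbit K L g ->
  f i < g j -> f (i + r)%nat < g (j + r)%nat.
Proof.
  intros HK HL Hf Hg H.
  induction r as [| r IH].
  - rewrite !Nat.add_0_r; exact H.
  - rewrite <- !plus_n_Sm.
    apply (step_lt K L HK HL) with (3 := IH); auto.
Qed.

(** A square root of the return map is determined by order alone: if
    [f (i + m)] and [S (f i)] differed, monotonicity of the step and of [S]
    would propagate the strict inequality through [m] more steps, so that
    [f (i + m + m)] would differ from [S (S (f i))]. *)
Lemma orbit_sqrt K L f m S :
  0 < K < 1 -> 0 < L < 1 -> orbit K L f ->
  (forall x y, x < y -> S x < S y) ->
  (forall x y, step K L x y -> step K L (S x) (S y)) ->
  (forall i, f (i + (m + m))%nat = S (S (f i))) ->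
  forall i, f (i + m)%nat = S (f i).
Proof.
  intros HK HL Hf Smono Sstep Hper i.
  assert (HSf : orbit K L (fun i => S (f i))) by (intro j; apply Sstep, Hf).
  specialize (Hper i); rewrite Nat.add_assoc in Hper.
  destruct (Rtotal_order (f (i + m)%nat) (S (f i))) as [H | [H | H]];
    [exfalso | exact H | exfalso].
  - pose proof (orbit_lt K L f (fun i => S (f i)) (i + m) i m HK HL Hf HSf H).
    pose proof (Smono _ _ H). simpl in *; lra.
  - pose proof (orbit_lt K L (fun i => S (f i)) f i (i + m) m HK HL HSf Hf H).
    pose proof (Smono _ _ H). simpl in *; lra.
Qed.

Lemma sin_IZR_PI k : sin (IZR k * PI) = 0.
Proof. apply sin_eq_0_1; exists k; reflexivity. Qed.

Lemma cos_IZR_PI_sq k : cos (IZR k * PI) ^ 2 = 1.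
Proof.
  pose proof (sin_sq_cos_sq (IZR k * PI)) as H; rewrite sin_IZR_PI in H; lra.
Qed.

Lemma cos_add_IZR_PI x k : cos (x + IZR k * PI) = cos (IZR k * PI) * cos x.
Proof. rewrite cos_plus, sin_IZR_PI; ring. Qed.

Lemma sin_add_IZR_PI x k : sin (x + IZR k * PI) = cos (IZR k * PI) * sin x.
Proof. rewrite sin_plus, sin_IZR_PI; ring. Qed.

Lemma step_add_IZR_PI K L k x y :
  step K L x y -> step K L (x + IZR k * PI) (y + IZR k * PI).
Proof.
  intros [H C]; split; [lra |].
  pose proof (chord_form_bilinear K L x y) as B.
  pose proof (chord_form_bilinear K L (x + IZR k * PI) (y + IZR k * PI)) as B'.
  rewrite !cos_add_IZR_PI, !sin_add_IZR_PI in B'.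
  pose proof (cos_IZR_PI_sq k) as E.
  replace (cos (IZR k * PI) * cos x * (cos (IZR k * PI) * cos y))
    with (cos (IZR k * PI) ^ 2 * (cos x * cos y)) in B' by ring.
  replace (cos (IZR k * PI) * sin x * (cos (IZR k * PI) * sin y))
    with (cos (IZR k * PI) ^ 2 * (sin x * sin y)) in B' by ring.
  rewrite E, !Rmult_1_l in B'.
  lra.
Qed.

Lemma same_cos_sin x y :
  cos y = cos x -> sin y = sin x -> exists k, y = x + 2 * (IZR k * PI).
Proof.
  intros Hc Hs.
  assert (H : cos (2 * ((y - x) / 2)) = 1).
  { replace (2 * ((y - x) / 2)) with (y - x) by field.
    rewrite cos_minus, Hc, Hs.
    pose proof (sin_sq_cos_sq x); lra. }
  rewrite cos_2a_sin in H.
  destruct (sin_eq_0_0 ((y - x) / 2)) as [k Hk]; [nra |].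
  exists k; lra.
Qed.

(** Closing up after [m + m] steps means advancing by [2 k PI], which is the
    square of the translation by [k PI]; the latter commutes with the step by
    central symmetry of the two conics. *)
Lemma orbit_half K L f m :
  0 < K < 1 -> 0 < L < 1 -> orbit K L f ->
  cos (f (m + m)%nat) = cos (f 0%nat) -> sin (f (m + m)%nat) = sin (f 0%nat) ->
  exists k, forall i, f (i + m)%nat = f i + IZR k * PI.
Proof.
  intros HK HL Hf Hc Hs.
  destruct (same_cos_sin _ _ Hc Hs) as [k Hk].
  exists k.
  assert (Hper : forall i, f (i + (m + m))%nat = f i + IZR k * PI + IZR k * PI).
  { intro i; induction i as [| i IH]; [rewrite Nat.add_0_l; lra |].
    apply (step_unique K L HK HL) with (f (i + (m + m))%nat); [apply Hf |].
    rewrite IH; do 2 apply step_add_IZR_PI; apply Hf. }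
  apply (orbit_sqrt K L f m (fun x => x + IZR k * PI) HK HL Hf).
  - intros; lra.
  - intros; apply step_add_IZR_PI; assumption.
  - exact Hper.
Qed.

(** * The quarter turn of the inner ellipse *)
Lemma ratio_bounds a lam : 0 < a -> 0 < lam -> 0 < a ^ 2 / (a ^ 2 + lam) < 1.
Proof.
  intros Ha Hlam; split; [apply Rdiv_lt_0_compat; nra |].
  apply Rmult_lt_reg_r with (a ^ 2 + lam); [nra |]. field_simplify; nra.
Qed.

Lemma acos_unit p q :
  p ^ 2 + q ^ 2 = 1 -> 0 < q ->
  0 < acos p < PI /\ cos (acos p) = p /\ sin (acos p) = q.
Proof.
  intros H Hq.
  assert (Hp : -1 < p < 1) by nra.
  assert (Hc : cos (acos p) = p) by (apply cos_acos; lra).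
  split; [apply acos_bound_lt; lra |]; split; [exact Hc |].
  rewrite sin_acos by lra.
  replace (1 - p²) with (q ^ 2) by (unfold Rsqr; lra).
  apply sqrt_pow2; lra.
Qed.

Section Quarter.
Variables a b : R.
Hypotheses (Ha : 0 < a) (Hb : 0 < b).

(** The length of the velocity [(- a sin x, b cos x)] of the ellipse at the
    eccentric angle [x]; the tangent there is at distance
    [a b / tangent_norm x] from the center. *)
Definition tangent_norm (x : R) : R := sqrt (a ^ 2 * sin x ^ 2 + b ^ 2 * cos x ^ 2).

(** The lift to the line of the self-map of the circle sending [(cos x, sin x)]
    to the direction of [(- a sin x, b cos x)], the velocity at [x].  For the
    invariant parameter of the confocal family this is the shift by a quarter
    period.  The added term is the angle in [(0, PI)] between these two
    vectors. *)
Definition quarter (x : R) : R :=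
  x + acos ((b - a) * (sin x * cos x) / tangent_norm x).

Lemma tangent_norm_sq x :
  tangent_norm x ^ 2 = a ^ 2 * sin x ^ 2 + b ^ 2 * cos x ^ 2.
Proof. unfold tangent_norm; rewrite pow2_sqrt; [reflexivity |]; nra. Qed.

Lemma tangent_norm_pos x : 0 < tangent_norm x.
Proof.
  apply sqrt_lt_R0.
  pose proof (sin_sq_cos_sq x) as E.
  assert (0 < a ^ 2) by nra. assert (0 < b ^ 2) by nra.
  assert (0 <= cos x ^ 2) by nra. assert (0 <= sin x ^ 2) by nra.
  destruct (Rle_lt_dec (cos x ^ 2) (1 / 2)); nra.
Qed.

Lemma quarter_spec x :
  x < quarter x < x + PI /\
  cos (quarter x) = - a * sin x / tangent_norm x /\
  sin (quarter x) = b * cos x / tangent_norm x.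
Proof.
  pose proof (tangent_norm_pos x) as HN.
  pose proof (tangent_norm_sq x) as HN2.
  pose proof (sin_sq_cos_sq x) as E.
  unfold quarter; set (N := tangent_norm x) in *.
  destruct (acos_unit ((b - a) * (sin x * cos x) / N)
              ((a * sin x ^ 2 + b * cos x ^ 2) / N)) as (B & Hc & Hs).
  - transitivity ((((b - a) * (sin x * cos x)) ^ 2 +
      (a * sin x ^ 2 + b * cos x ^ 2) ^ 2) / N ^ 2); [field; lra |].
    replace (((b - a) * (sin x * cos x)) ^ 2 + (a * sin x ^ 2 + b * cos x ^ 2) ^ 2)
      with (N ^ 2); [field; lra |].
    transitivity (N ^ 2 * (sin x ^ 2 + cos x ^ 2)); [rewrite E; ring |].
    rewrite HN2; ring.
  - apply Rdiv_lt_0_compat; [| exact HN].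
    assert (0 <= cos x ^ 2) by nra. assert (0 <= sin x ^ 2) by nra.
    destruct (Rle_lt_dec (cos x ^ 2) (1 / 2)); nra.
  - split; [lra |].
    rewrite cos_plus, sin_plus, Hc, Hs; split.
    + transitivity (- a * sin x * (sin x ^ 2 + cos x ^ 2) / N); [field; lra |].
      rewrite E; field; lra.
    + transitivity (b * cos x * (sin x ^ 2 + cos x ^ 2) / N); [field; lra |].
      rewrite E; field; lra.
Qed.

(** For [y - x < PI] the linear map [(c, s) -> (- a s, b c)] preserves
    orientation, so the sine of the difference stays positive; for
    [y - x >= PI] the displacement of less than [PI] cannot reverse the order. *)
Lemma quarter_lt x y : x < y -> quarter x < quarter y.
Proof.
  intros H.
  destruct (quarter_spec x) as (Bx & Cx & Sx).
  destruct (quarter_spec y) as (By & Cy & Sy).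
  destruct (Rlt_le_dec (y - x) PI) as [Hlt | Hge]; [| lra].
  assert (Hs : 0 < sin (quarter y - quarter x)).
  { rewrite sin_minus, Cx, Sx, Cy, Sy.
    pose proof (tangent_norm_pos x); pose proof (tangent_norm_pos y).
    replace (b * cos y / tangent_norm y * (- a * sin x / tangent_norm x) -
             - a * sin y / tangent_norm y * (b * cos x / tangent_norm x))
      with (a * b * sin (y - x) / (tangent_norm x * tangent_norm y))
      by (rewrite sin_minus; field; lra).
    assert (0 < sin (y - x)) by (apply sin_gt_0; lra).
    apply Rdiv_lt_0_compat; repeat apply Rmult_lt_0_compat; assumption. }
  destruct (Rlt_le_dec (quarter x) (quarter y)) as [Hq | Hq]; [exact Hq | exfalso].
  destruct Hq as [Hq | Hq].
  - assert (sin (quarter y - quarter x) < 0) by (apply sin_lt_0_var; lra).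
    lra.
  - rewrite Hq, Rminus_diag, sin_0 in Hs; lra.
Qed.

Lemma quarter_add_IZR_PI x k : quarter (x + IZR k * PI) = quarter x + IZR k * PI.
Proof.
  unfold quarter, tangent_norm.
  rewrite cos_add_IZR_PI, sin_add_IZR_PI.
  set (e := cos (IZR k * PI)).
  assert (E : e ^ 2 = 1) by apply cos_IZR_PI_sq.
  replace (e * sin x * (e * cos x)) with (e ^ 2 * (sin x * cos x)) by ring.
  rewrite !Rpow_mult_distr, E, !Rmult_1_l; ring.
Qed.

Lemma tangent_norm_quarter x : tangent_norm x * tangent_norm (quarter x) = a * b.
Proof.
  destruct (quarter_spec x) as (B & C & S).
  pose proof (tangent_norm_pos x) as HN.
  pose proof (tangent_norm_pos (quarter x)) as HN'.
  pose proof (tangent_norm_sq (quarter x)) as H'.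
  pose proof (sin_sq_cos_sq x) as E.
  rewrite C, S in H'.
  assert (H : (tangent_norm x * tangent_norm (quarter x)) ^ 2 = (a * b) ^ 2).
  { rewrite Rpow_mult_distr, H'.
    transitivity ((a * b) ^ 2 * (sin x ^ 2 + cos x ^ 2)); [field; lra |].
    rewrite E; ring. }
  assert (0 < tangent_norm x * tangent_norm (quarter x))
    by (apply Rmult_lt_0_compat; assumption).
  assert (0 < a * b) by (apply Rmult_lt_0_compat; assumption).
  nra.
Qed.

(** The linear map [(c, s) -> (- a s, b c)] squares to [- a b] times the
    identity. *)
Lemma quarter_quarter x : quarter (quarter x) = x + PI.
Proof.
  destruct (quarter_spec x) as (B & C & S).
  destruct (quarter_spec (quarter x)) as (B' & C' & S').
  pose proof (tangent_norm_quarter x) as HN.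
  pose proof (tangent_norm_pos x) as Hx.
  pose proof (tangent_norm_pos (quarter x)) as Hqx.
  rewrite S in C'; rewrite C in S'.
  assert (Hs : sin (quarter (quarter x) - (x + PI)) = 0).
  { rewrite sin_minus, neg_sin, neg_cos, C', S'; field; lra. }
  destruct (Rtotal_order (quarter (quarter x) - (x + PI)) 0) as [H | [H | H]].
  - assert (sin (quarter (quarter x) - (x + PI)) < 0) by (apply sin_lt_0_var; lra).
    lra.
  - lra.
  - assert (0 < sin (quarter (quarter x) - (x + PI))) by (apply sin_gt_0; lra).
    lra.
Qed.

Variable lam : R.
Hypothesis Hlam : 0 < lam.
Let K := a ^ 2 / (a ^ 2 + lam).
Let L := b ^ 2 / (b ^ 2 + lam).

(** Since the conics are confocal, [K] and [L] are given by one parameter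
    [lam], and the relation is quadratic in it. *)
Lemma step_polynomial x y :
  2 * (a ^ 2 + lam) * (b ^ 2 + lam) * chord_form K L x y =
  a ^ 2 * b ^ 2 * (1 - cos (y - x))
  - 2 * lam * (b ^ 2 * (cos x * cos y) + a ^ 2 * (sin x * sin y))
  - lam ^ 2 * (1 + cos (y - x)).
Proof.
  replace (2 * (a ^ 2 + lam) * (b ^ 2 + lam) * chord_form K L x y)
    with ((a ^ 2 + lam) * (b ^ 2 + lam) * (2 * chord_form K L x y)) by ring.
  rewrite chord_form_bilinear, cos_minus.
  unfold K, L; field; split; nra.
Qed.

(** Write [V = cos (y - x)], [N] and [N'] for the two tangent norms, and [S]
    for the mixed term in [step_polynomial].  The step relation makes [N N']
    equal to [S + lam (1 + V)]: both have the same square, and the negative root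
    is excluded because [V < 1].  This removes the square roots, and the
    relation for the images becomes a multiple of the relation for [x], [y]. *)
Lemma step_quarter x y : step K L x y -> step K L (quarter x) (quarter y).
Proof.
  intros [H C].
  pose proof (step_polynomial x y) as P; rewrite C, Rmult_0_r in P.
  pose proof (step_polynomial (quarter x) (quarter y)) as P'.
  destruct (quarter_spec x) as (Bx & Cx & Sx).
  destruct (quarter_spec y) as (By & Cy & Sy).
  pose proof (tangent_norm_pos x) as Hx; pose proof (tangent_norm_pos y) as Hy.
  pose proof (tangent_norm_sq x) as Nx; pose proof (tangent_norm_sq y) as Ny.
  pose proof (sin_sq_cos_sq x) as Ex; pose proof (sin_sq_cos_sq y) as Ey.
  split.
  { split; [apply quarter_lt; lra |].
    pose proof (quarter_add_IZR_PI x 1) as Hq; rewrite Rmult_1_l in Hq.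
    rewrite <- Hq; apply quarter_lt; lra. }
  assert (Hv : cos (y - x) < 1).
  { rewrite <- cos_0; apply cos_decreasing_1; lra. }
  rewrite !cos_minus in *; rewrite Cx, Cy, Sx, Sy in P'.
  set (N := tangent_norm x) in *; set (N' := tangent_norm y) in *.
  set (c := cos x) in *; set (s := sin x) in *.
  set (c' := cos y) in *; set (s' := sin y) in *.
  set (V := c' * c + s' * s) in *.
  set (S := b ^ 2 * (c * c') + a ^ 2 * (s * s')) in *.
  set (Z := S + lam * (1 + V)).
  assert (HV : (c * s' - s * c') ^ 2 = (1 - V) * (1 + V)).
  { replace ((1 - V) * (1 + V)) with (1 - V ^ 2) by ring.
    unfold V.
    replace (1 - (c' * c + s' * s) ^ 2) with
      (1 - (c ^ 2 + s ^ 2) * (c' ^ 2 + s' ^ 2) + (c * s' - s * c') ^ 2) by ring.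
    rewrite Ex, Ey; ring. }
  assert (HNN : (N * N') ^ 2 = S ^ 2 + a ^ 2 * b ^ 2 * ((1 - V) * (1 + V))).
  { rewrite Rpow_mult_distr, Nx, Ny, <- HV; unfold S; ring. }
  (* Modulo the step relation the two squares agree. *)
  assert (HZ : (N * N') ^ 2 = Z ^ 2).
  { rewrite HNN; unfold Z.
    replace (a ^ 2 * b ^ 2 * ((1 - V) * (1 + V))) with
      ((2 * lam * S + lam ^ 2 * (1 + V)) * (1 + V)); [ring |].
    replace (2 * lam * S + lam ^ 2 * (1 + V)) with (a ^ 2 * b ^ 2 * (1 - V)) by lra.
    ring. }
  assert (HNp : 0 < N * N') by (apply Rmult_lt_0_compat; assumption).
  set (n := N * N') in *.
  assert (HSle : S <= n).
  { assert (0 <= a ^ 2 * b ^ 2 * ((1 - V) * (1 + V))).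
    { rewrite <- HV; apply Rmult_le_pos; [apply Rmult_le_pos |]; apply pow2_ge_0. }
    destruct (Rle_lt_dec S n) as [Hle | Hlt]; [exact Hle | exfalso].
    assert (0 < (S - n) * (S + n)) by (apply Rmult_lt_0_compat; lra).
    lra. }
  assert (HZp : n = Z).
  { assert (0 < lam * Z + lam * S).
    { unfold Z. assert (0 < a ^ 2 * b ^ 2 * (1 - V)).
      { repeat apply Rmult_lt_0_compat; lra. }
      lra. }
    assert (0 < Z + S) by nra.
    assert (HF : (n - Z) * (n + Z) = 0)
      by (replace ((n - Z) * (n + Z)) with (n ^ 2 - Z ^ 2) by ring; lra).
    apply Rmult_integral in HF; lra. }
  assert (HF : forall r, n * r = 0 -> r = 0) by (intros r Hr; nra).
  apply (Rmult_eq_reg_l (2 * (a ^ 2 + lam) * (b ^ 2 + lam))).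
  2:{ assert (0 < a ^ 2 + lam) by nra. assert (0 < b ^ 2 + lam) by nra.
      assert (0 < (a ^ 2 + lam) * (b ^ 2 + lam)) by nra. lra. }
  rewrite Rmult_0_r, P'.
  apply HF.
  transitivity (a ^ 2 * b ^ 2 * (n - S) - 2 * lam * (a ^ 2 * b ^ 2 * V)
                - lam ^ 2 * (n + S)).
  { unfold n, S, V; field; lra. }
  rewrite HZp; unfold Z.
  replace (a ^ 2 * b ^ 2 * (S + lam * (1 + V) - S) - 2 * lam * (a ^ 2 * b ^ 2 * V)
    - lam ^ 2 * (S + lam * (1 + V) + S))
   with (lam * (a ^ 2 * b ^ 2 * (1 - V) - 2 * lam * S - lam ^ 2 * (1 + V))) by ring.
  rewrite <- P; ring.
Qed.

(** The map [quarter] followed by the translation by [j PI] commutes with the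
    step and squares to the translation by [(2 j + 1) PI]; so it is what [m]
    steps do. *)
Lemma orbit_quarter f m j :
  orbit K L f ->
  (forall i, f (i + (m + m))%nat = f i + IZR (2 * j + 1) * PI) ->
  forall i, tangent_norm (f i) * tangent_norm (f (i + m)%nat) = a * b.
Proof.
  intros Hf Hper i.
  pose proof (ratio_bounds a lam Ha Hlam) as HK; fold K in HK.
  pose proof (ratio_bounds b lam Hb Hlam) as HL; fold L in HL.
  rewrite (orbit_sqrt K L f m (fun x => quarter x + IZR j * PI) HK HL Hf).
  - rewrite <- (tangent_norm_quarter (f i)); f_equal.
    unfold tangent_norm.
    rewrite cos_add_IZR_PI, sin_add_IZR_PI, !Rpow_mult_distr, cos_IZR_PI_sq.
    f_equal; ring.
  - intros x y H; apply Rplus_lt_compat_r, quarter_lt, H.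
  - intros x y H; apply step_add_IZR_PI, step_quarter, H.
  - intro k; rewrite quarter_add_IZR_PI, quarter_quarter, Hper.
    rewrite plus_IZR, mult_IZR; ring.
Qed.

End Quarter.

(** * Tangents to the unit circle inscribed in a conic *)

(** The equation [c x + s y = 1] treats points and lines symmetrically, so this
    says both that two distinct points lie on one line missing the origin, and
    that two distinct such lines meet in at most one point. *)
Lemma incidence_unique x1 y1 x2 y2 c s c' s' :
  (x1, y1) <> (x2, y2) ->
  c * x1 + s * y1 = 1 -> c * x2 + s * y2 = 1 ->
  c' * x1 + s' * y1 = 1 -> c' * x2 + s' * y2 = 1 ->
  (c, s) = (c', s').
Proof.
  intros Hne H1 H2 H1' H2'.
  assert (HD : x1 * y2 - x2 * y1 <> 0).
  { intro D; apply Hne.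
    assert (Ex : x1 - x2 = s * (x1 * y2 - x2 * y1)).
    { transitivity (x1 * (c * x2 + s * y2) - x2 * (c * x1 + s * y1));
      [rewrite H1, H2; ring | ring]. }
    assert (Ey : y1 - y2 = - c * (x1 * y2 - x2 * y1)).
    { transitivity (y1 * (c * x2 + s * y2) - y2 * (c * x1 + s * y1));
      [rewrite H1, H2; ring | ring]. }
    rewrite D in Ex, Ey; f_equal; lra. }
  f_equal; apply (Rmult_eq_reg_r (x1 * y2 - x2 * y1)); try exact HD.
  - transitivity ((c * x1 + s * y1) * y2 - (c * x2 + s * y2) * y1); [ring |].
    rewrite H1, H2, <- H1' at 1; rewrite <- H2' at 1; ring.
  - transitivity ((c * x2 + s * y2) * x1 - (c * x1 + s * y1) * x2); [ring |].
    rewrite H1, H2, <- H2' at 1; rewrite <- H1' at 1; ring.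
Qed.

Lemma angle_exists c s : c ^ 2 + s ^ 2 = 1 -> exists x, cos x = c /\ sin x = s.
Proof.
  intros H.
  assert (Hc : -1 <= c <= 1) by nra.
  assert (Hs : sin (acos c) = Rabs s).
  { rewrite sin_acos by exact Hc.
    replace (1 - c²) with (s²) by (unfold Rsqr; lra).
    apply sqrt_Rsqr_abs. }
  destruct (Rle_lt_dec 0 s) as [H0 | H0].
  - exists (acos c); rewrite cos_acos, Hs, Rabs_pos_eq by assumption; split; reflexivity.
  - exists (- acos c); rewrite cos_neg, sin_neg, cos_acos, Hs, Rabs_left by assumption.
    split; lra.
Qed.

Section Conic.
Variables K L : R.
Hypotheses (HK : 0 < K < 1) (HL : 0 < L < 1).

Lemma line_point c s x y :
  c ^ 2 + s ^ 2 = 1 -> c * x + s * y = 1 ->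
  x = c - (c * y - s * x) * s /\ y = s + (c * y - s * x) * c.
Proof.
  intros H1 H2; split.
  - transitivity (x * (c ^ 2 + s ^ 2)); [rewrite H1; ring |].
    transitivity (c * (c * x + s * y) - (c * y - s * x) * s); [ring | rewrite H2; ring].
  - transitivity (y * (c ^ 2 + s ^ 2)); [rewrite H1; ring |].
    transitivity (s * (c * x + s * y) + (c * y - s * x) * c); [ring | rewrite H2; ring].
Qed.

Lemma line_conic c s x y :
  c ^ 2 + s ^ 2 = 1 -> c * x + s * y = 1 -> K * x ^ 2 + L * y ^ 2 = 1 ->
  (K * s ^ 2 + L * c ^ 2) * (c * y - s * x) ^ 2
  + 2 * (L - K) * (s * c) * (c * y - s * x) + (K * c ^ 2 + L * s ^ 2 - 1) = 0.
Proof.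
  intros H1 H2 H3.
  destruct (line_point c s x y H1 H2) as [Ex Ey].
  set (t := c * y - s * x) in *.
  rewrite Ex, Ey in H3; lra.
Qed.

(** Here [c y - s x] is the signed distance from the point of contact [(c, s)].
    Along the line the conic is a quadratic with positive leading coefficient
    and negative constant term, the point of contact being inside, so its two
    roots have opposite signs. *)
Lemma chord_ends_opposite c s x y x' y' :
  c ^ 2 + s ^ 2 = 1 -> c * x + s * y = 1 -> c * x' + s * y' = 1 ->
  K * x ^ 2 + L * y ^ 2 = 1 -> K * x' ^ 2 + L * y' ^ 2 = 1 ->
  (x, y) <> (x', y') -> (c * y - s * x) * (c * y' - s * x') < 0.
Proof.
  intros Hcs H H' C C' Hne.
  pose proof (line_conic c s x y Hcs H C) as Q.
  pose proof (line_conic c s x' y' Hcs H' C') as Q'.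
  destruct (line_point c s x y Hcs H) as [Ex Ey].
  destruct (line_point c s x' y' Hcs H') as [Ex' Ey'].
  set (t := c * y - s * x) in *; set (t' := c * y' - s * x') in *.
  assert (Ht : t - t' <> 0).
  { intro E; apply Hne.
    assert (E' : t = t') by lra.
    rewrite Ex, Ey, Ex', Ey', E'; reflexivity. }
  assert (Hk : K * c ^ 2 + L * s ^ 2 - 1 < 0).
  { pose proof (pow2_ge_0 c); pose proof (pow2_ge_0 s).
    destruct (Rle_lt_dec (c ^ 2) (1 / 2)); nra. }
  assert (Ha : 0 <= K * s ^ 2 + L * c ^ 2).
  { pose proof (pow2_ge_0 c); pose proof (pow2_ge_0 s); nra. }
  set (al := K * s ^ 2 + L * c ^ 2) in *.
  set (ka := K * c ^ 2 + L * s ^ 2 - 1) in *.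
  assert (E : al * (t + t') + 2 * (L - K) * (s * c) = 0).
  { apply (Rmult_eq_reg_l (t - t')); [| exact Ht]. lra. }
  assert (Hp : al * (t * t') = ka).
  { replace (al * (t * t')) with
      (al * (t + t') * t - al * t ^ 2) by ring.
    replace (al * (t + t')) with (- (2 * (L - K) * (s * c))) by lra. lra. }
  destruct (Rlt_le_dec (t * t') 0) as [G | G]; [exact G | exfalso].
  pose proof (Rmult_le_pos _ _ Ha G); lra.
Qed.

Lemma conic_line_third c s x1 y1 x2 y2 x3 y3 :
  c ^ 2 + s ^ 2 = 1 ->
  c * x1 + s * y1 = 1 -> c * x2 + s * y2 = 1 -> c * x3 + s * y3 = 1 ->
  K * x1 ^ 2 + L * y1 ^ 2 = 1 -> K * x2 ^ 2 + L * y2 ^ 2 = 1 ->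
  K * x3 ^ 2 + L * y3 ^ 2 = 1 ->
  (x1, y1) <> (x2, y2) -> (x2, y2) <> (x3, y3) -> (x3, y3) = (x1, y1).
Proof.
  intros Hcs H1 H2 H3 C1 C2 C3 N1 N2.
  pose proof (chord_ends_opposite c s x1 y1 x2 y2 Hcs H1 H2 C1 C2 N1) as P1.
  pose proof (chord_ends_opposite c s x2 y2 x3 y3 Hcs H2 H3 C2 C3 N2) as P2.
  assert (E : {(x3, y3) = (x1, y1)} + {(x3, y3) <> (x1, y1)}).
  { destruct (Req_dec_T x3 x1), (Req_dec_T y3 y1); subst; auto; right; congruence. }
  destruct E as [E | E]; [exact E | exfalso].
  pose proof (chord_ends_opposite c s x3 y3 x1 y1 Hcs H3 H1 C3 C1 E) as P3.
  set (t1 := c * y1 - s * x1) in *; set (t2 := c * y2 - s * x2) in *.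
  set (t3 := c * y3 - s * x3) in *.
  assert (0 < - (t1 * t2) * - (t2 * t3)) by (apply Rmult_lt_0_compat; lra).
  pose proof (pow2_ge_0 t2); nra.
Qed.

(** The two tangent segments from [(x, y)] have equal length [t], and the
    rotation taking one point of contact to the other has half-angle
    [atan t]. *)
Lemma second_tangent c s c' s' x y :
  c ^ 2 + s ^ 2 = 1 -> c' ^ 2 + s' ^ 2 = 1 ->
  c * x + s * y = 1 -> c' * x + s' * y = 1 -> (c, s) <> (c', s') ->
  let d := atan (c * y - s * x) in
  c' = c * cos (2 * d) - s * sin (2 * d) /\
  s' = s * cos (2 * d) + c * sin (2 * d) /\
  c' * y - s' * x = - (c * y - s * x).
Proof.
  intros Hcs Hcs' H H' Hne d.
  destruct (line_point c s x y Hcs H) as [Ex Ey].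
  assert (Hd : tan d = c * y - s * x) by apply tan_atan.
  set (t := c * y - s * x) in *.
  assert (Bd : - PI / 2 < d < PI / 2) by apply atan_bound.
  assert (Hc : 0 < cos d) by (apply cos_gt_0; lra).
  assert (Hsd : sin d = t * cos d) by (rewrite <- Hd; unfold tan; field; lra).
  assert (E1 : (1 + t ^ 2) * cos d ^ 2 = 1).
  { pose proof (sin_sq_cos_sq d) as E; rewrite Hsd in E; lra. }
  set (p := c * c' + s * s'); set (r := c * s' - s * c').
  assert (Hpr : p + t * r = 1).
  { rewrite <- H', Ex, Ey; unfold p, r; ring. }
  assert (Hpr2 : p ^ 2 + r ^ 2 = 1).
  { transitivity ((c ^ 2 + s ^ 2) * (c' ^ 2 + s' ^ 2)); [unfold p, r; ring |].
    rewrite Hcs, Hcs'; ring. }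
  assert (Ec : c' = c * p - s * r).
  { transitivity (c' * (c ^ 2 + s ^ 2)); [rewrite Hcs; ring | unfold p, r; ring]. }
  assert (Es : s' = s * p + c * r).
  { transitivity (s' * (c ^ 2 + s ^ 2)); [rewrite Hcs; ring | unfold p, r; ring]. }
  assert (Hr : r * (1 + t ^ 2) = 2 * t).
  { apply (Rmult_eq_reg_l r).
    - assert (E : p = 1 - t * r) by lra. rewrite E in Hpr2; lra.
    - intro E; apply Hne. rewrite E in *.
      assert (p = 1) by lra. rewrite Ec, Es; f_equal; rewrite H0; ring. }
  assert (Er : r = sin (2 * d)).
  { rewrite sin_2a, Hsd.
    transitivity (r * ((1 + t ^ 2) * cos d ^ 2)); [rewrite E1; ring |].
    rewrite <- Rmult_assoc, Hr; ring. }
  assert (Ep : p = cos (2 * d)).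
  { rewrite cos_2a_sin, Hsd.
    transitivity (1 - t * r); [lra |].
    rewrite Er, sin_2a, Hsd; ring. }
  split; [| split].
  - rewrite <- Er, <- Ep; exact Ec.
  - rewrite <- Er, <- Ep; exact Es.
  - transitivity (- r + t * p).
    + rewrite Ex, Ey; unfold p, r; ring.
    + replace p with (1 - t * r) by lra. lra.
Qed.

Lemma tangent_chord_step c s phi x y :
  cos phi = c -> sin phi = s -> c * x + s * y = 1 -> K * x ^ 2 + L * y ^ 2 = 1 ->
  chord_form K L phi (phi + 2 * atan (c * y - s * x)) = 0.
Proof.
  intros Hc Hs H C.
  assert (Hcs : c ^ 2 + s ^ 2 = 1).
  { rewrite <- Hc, <- Hs; pose proof (sin_sq_cos_sq phi); lra. }
  destruct (line_point c s x y Hcs H) as [Ex Ey].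
  set (t := c * y - s * x) in *.
  rewrite chord_form_tan, tan_atan, Hc, Hs.
  - replace (c - t * s) with x by lra. replace (s + t * c) with y by lra.
    rewrite C; ring.
  - pose proof (atan_bound t). apply Rgt_not_eq, cos_gt_0; lra.
Qed.

(** All turning angles have the same sign.  The signed distance of a vertex
    along the next side is opposite to the one along the previous side, and the
    two ends of a side have opposite signed distances; so the sign passes from
    side to side.  A clockwise polygon is treated through its mirror image. *)
Lemma poncelet_orbit (x y c s : nat -> R) :
  (forall i, K * x i ^ 2 + L * y i ^ 2 = 1) ->
  (forall i, c i ^ 2 + s i ^ 2 = 1) ->
  (forall i, c i * x i + s i * y i = 1) ->
  (forall i, c i * x (S i) + s i * y (S i) = 1) ->
  (forall i, (x i, y i) <> (x (S i), y (S i))) ->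
  (forall i, (c i, s i) <> (c (S i), s (S i))) ->
  exists f : nat -> R,
    (forall i, cos (f i) = c i /\ sin (f i) = s i) /\
    (orbit K L f \/ orbit K L (fun i => - f i)).
Proof.
  intros HC Hcs H H' Hne Hne'.
  destruct (angle_exists _ _ (Hcs 0%nat)) as (f0 & Hc0 & Hs0).
  set (T := fun i => c i * y (S i) - s i * x (S i)).
  set (f := fix f i := match i with O => f0 | S j => f j + 2 * atan (T j) end).
  assert (Hf : forall i, cos (f i) = c i /\ sin (f i) = s i).
  { intro i; induction i as [| i [IHc IHs]]; [split; assumption |].
    destruct (second_tangent (c i) (s i) (c (S i)) (s (S i)) (x (S i)) (y (S i)))
      as (Ec & Es & _); auto.
    fold (T i) in Ec, Es.
    cbn [f]; rewrite cos_plus, sin_plus, IHc, IHs, Ec, Es; split; ring. }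
  exists f; split; [exact Hf |].
  assert (HT : forall i, 0 < T i * T (S i)).
  { intro i.
    pose proof (chord_ends_opposite (c (S i)) (s (S i)) (x (S i)) (y (S i))
      (x (S (S i))) (y (S (S i)))) as P.
    destruct (second_tangent (c i) (s i) (c (S i)) (s (S i)) (x (S i)) (y (S i)))
      as (_ & _ & E); auto.
    rewrite E in P; fold (T i) (T (S i)) in P.
    assert (- T i * T (S i) < 0) by (apply P; auto). lra. }
  assert (Hform : forall i, chord_form K L (f i) (f (S i)) = 0).
  { intro i; destruct (Hf i) as [Hc Hs]; cbn [f].
    apply tangent_chord_step; auto. }
  destruct (Rtotal_order (T 0%nat) 0) as [H0 | [H0 | H0]].
  - right.
    assert (Hneg : forall i, T i < 0).
    { intro i; induction i as [| i IH]; [exact H0 |]. specialize (HT i); nra. }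
    intro i; split.
    + pose proof (atan_bound (T i)) as B.
      assert (atan (T i) < 0).
      { rewrite <- atan_0; apply atan_increasing, Hneg. }
      cbn [f]; lra.
    + rewrite <- (Hform i); apply chord_form_opp.
  - specialize (HT 0%nat); rewrite H0 in HT; lra.
  - left.
    assert (Hpos : forall i, 0 < T i).
    { intro i; induction i as [| i IH]; [exact H0 |]. specialize (HT i); nra. }
    intro i; split; [| apply Hform].
    pose proof (atan_bound (T i)) as B.
    assert (0 < atan (T i)).
    { rewrite <- atan_0; apply atan_increasing, Hpos. }
    cbn [f]; lra.
Qed.
End Conic.

(** * Coordinates adapted to the inner ellipse *)

(** Components along the axes of [g] in units of the semi-axes; in these [g]
    becomes the unit circle and its tangents are [c x + s y = 1] with
    [c^2 + s^2 = 1]. *)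
Definition scaled_x (g : ellipse) (v : point) : R := dot v (axis g) / semi_major g.
Definition scaled_y (g : ellipse) (v : point) : R :=
  dot v (rot90 (axis g)) / semi_minor g.

Definition coord_x (g : ellipse) (X : point) : R := scaled_x g (vsub X (center g)).
Definition coord_y (g : ellipse) (X : point) : R := scaled_y g (vsub X (center g)).

Lemma ellipse_form_coord g X : ellipse_form g X = coord_x g X ^ 2 + coord_y g X ^ 2.
Proof. reflexivity. Qed.

Lemma axis_sq g : fst (axis g) ^ 2 + snd (axis g) ^ 2 = 1.
Proof.
  pose proof (axis_unit g) as H; unfold norm, dot in H.
  transitivity (sqrt (fst (axis g) * fst (axis g) + snd (axis g) * snd (axis g)) ^ 2).
  - rewrite pow2_sqrt; nra.
  - rewrite H; ring.
Qed.

Lemma semi_major_pos g : 0 < semi_major g.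
Proof. pose proof (semi_minor_pos g); pose proof (semi_minor_le_major g); lra. Qed.

Lemma dot_scaled g u v :
  dot u v = semi_major g ^ 2 * (scaled_x g u * scaled_x g v)
            + semi_minor g ^ 2 * (scaled_y g u * scaled_y g v).
Proof.
  pose proof (semi_major_pos g); pose proof (semi_minor_pos g).
  transitivity ((fst (axis g) ^ 2 + snd (axis g) ^ 2) * dot u v);
    [rewrite axis_sq; ring |].
  unfold scaled_x, scaled_y, dot, rot90; simpl; field; split; lra.
Qed.

Lemma scaled_inj g u v :
  scaled_x g u = scaled_x g v -> scaled_y g u = scaled_y g v -> u = v.
Proof.
  intros Hx Hy.
  assert (H : dot (vsub u v) (vsub u v) = 0).
  { rewrite (dot_scaled g).
    assert (Ex : scaled_x g (vsub u v) = scaled_x g u - scaled_x g v)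
      by (unfold scaled_x, dot, vsub; simpl; unfold Rdiv; ring).
    assert (Ey : scaled_y g (vsub u v) = scaled_y g u - scaled_y g v)
      by (unfold scaled_y, dot, vsub; simpl; unfold Rdiv; ring).
    rewrite Ex, Ey, Hx, Hy; ring. }
  destruct u as [u1 u2], v as [v1 v2]; unfold dot, vsub in H; simpl in H.
  destruct (Rplus_sqr_eq_0 (u1 - v1) (u2 - v2) H) as [E1 E2].
  f_equal; lra.
Qed.

Lemma coord_inj g X Y : (coord_x g X, coord_y g X) = (coord_x g Y, coord_y g Y) -> X = Y.
Proof.
  intros H; injection H as Hx Hy.
  pose proof (scaled_inj g _ _ Hx Hy) as E.
  destruct X as [x1 x2], Y as [y1 y2]; unfold vsub in E; simpl in E.
  injection E as E1 E2; f_equal; lra.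
Qed.

Lemma coord_x_line g P s t :
  coord_x g (vadd P (vscale s t)) = coord_x g P + s * scaled_x g t.
Proof. unfold coord_x, scaled_x, vsub, vadd, vscale, dot; simpl; unfold Rdiv; ring. Qed.

Lemma coord_y_line g P s t :
  coord_y g (vadd P (vscale s t)) = coord_y g P + s * scaled_y g t.
Proof.
  unfold coord_y, scaled_y, vsub, vadd, vscale, dot; simpl; unfold Rdiv; ring.
Qed.

Lemma scaled_x_vsub g X Y : scaled_x g (vsub X Y) = coord_x g X - coord_x g Y.
Proof. unfold coord_x, scaled_x, vsub, dot; simpl; unfold Rdiv; ring. Qed.

Lemma scaled_y_vsub g X Y : scaled_y g (vsub X Y) = coord_y g X - coord_y g Y.
Proof. unfold coord_y, scaled_y, vsub, dot; simpl; unfold Rdiv; ring. Qed.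

(** Stated for any conic that is diagonal in the frame of [g]: it serves both
    for [g] itself and for the outer ellipse. *)
Lemma tangent_dir_iff g e K L P t :
  (forall X, ellipse_form e X = K * coord_x g X ^ 2 + L * coord_y g X ^ 2) ->
  (tangent_dir e P t <->
   t <> zero /\ K * coord_x g P * scaled_x g t + L * coord_y g P * scaled_y g t = 0).
Proof.
  intros Hform.
  set (l := K * coord_x g P * scaled_x g t + L * coord_y g P * scaled_y g t).
  assert (HD : derivable_pt_lim (fun s => ellipse_form e (vadd P (vscale s t))) 0 (2 * l)).
  { apply derivable_pt_lim_ext with (fun s =>
      K * (coord_x g P + s * scaled_x g t) ^ 2 + L * (coord_y g P + s * scaled_y g t) ^ 2).
    { intro s; rewrite Hform, coord_x_line, coord_y_line; reflexivity. }
    intros eps Heps.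
    set (q := K * scaled_x g t ^ 2 + L * scaled_y g t ^ 2).
    assert (Hq : 0 < Rabs q + 1) by (pose proof (Rabs_pos q); lra).
    assert (Hdel : 0 < eps / (Rabs q + 1)) by (apply Rdiv_lt_0_compat; lra).
    exists (mkposreal _ Hdel); intros h Hh Hlt; simpl in Hlt.
    match goal with |- Rabs ?r < _ => replace r with (q * h) by (unfold q, l; field; exact Hh) end.
    rewrite Rabs_mult.
    apply Rle_lt_trans with ((Rabs q + 1) * Rabs h);
      [pose proof (Rabs_pos h); nra |].
    apply (Rmult_lt_compat_l _ _ _ Hq) in Hlt.
    replace ((Rabs q + 1) * (eps / (Rabs q + 1))) with eps in Hlt by (field; lra).
    exact Hlt. }
  unfold tangent_dir; split; intros [Ht H]; (split; [exact Ht |]).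
  - pose proof (uniqueness_limite _ _ _ _ HD H); lra.
  - replace 0 with (2 * l) at 2 by lra. exact HD.
Qed.

Lemma line_tangent_coord g A B :
  A <> B -> line_tangent g A B ->
  exists c s, c ^ 2 + s ^ 2 = 1 /\
    c * coord_x g A + s * coord_y g A = 1 /\
    c * coord_x g B + s * coord_y g B = 1.
Proof.
  intros Hne (P & HP & (r & Hr) & Ht).
  apply (tangent_dir_iff g g 1 1) in Ht;
    [| intro X; rewrite ellipse_form_coord; ring].
  destruct Ht as [_ Ht].
  unfold on_ellipse in HP; rewrite ellipse_form_coord in HP.
  rewrite scaled_x_vsub, scaled_y_vsub in Ht.
  assert (Ex : coord_x g P = coord_x g A + r * (coord_x g B - coord_x g A))
    by (rewrite Hr, coord_x_line, scaled_x_vsub; reflexivity).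
  assert (Ey : coord_y g P = coord_y g A + r * (coord_y g B - coord_y g A))
    by (rewrite Hr, coord_y_line, scaled_y_vsub; reflexivity).
  exists (coord_x g P), (coord_y g P); split; [exact HP |].
  set (x := coord_x g P) in *; set (y := coord_y g P) in *.
  set (d := coord_x g B - coord_x g A) in *.
  set (d' := coord_y g B - coord_y g A) in *.
  assert (E : x * coord_x g A + y * coord_y g A = 1).
  { transitivity (x ^ 2 + y ^ 2 - r * (1 * x * d + 1 * y * d'));
      [rewrite Ex at 2; rewrite Ey at 2 | rewrite HP, Ht; ring].
    replace (coord_x g A) with (x - r * d) by lra.
    replace (coord_y g A) with (y - r * d') by lra. ring. }
  split; [exact E |].
  rewrite <- E; unfold d, d' in Ht; lra.
Qed.

(** The center is the midpoint of the foci.  Since [g] is not a circle its foci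
    are distinct, so they determine the axis up to sign. *)
Lemma confocal_center_axis g e :
  confocal g e -> semi_minor g < semi_major g ->
  center e = center g /\ (axis e = axis g \/ axis e = vopp (axis g)) /\
  semi_major e ^ 2 - semi_minor e ^ 2 = semi_major g ^ 2 - semi_minor g ^ 2.
Proof.
  intros Hc Hlt.
  pose proof (axis_sq g) as Ug; pose proof (axis_sq e) as Ue.
  pose proof (semi_minor_pos g); pose proof (semi_minor_pos e).
  pose proof (semi_minor_le_major e).
  assert (Hf : 0 < focal_dist g) by (apply sqrt_lt_R0; nra).
  assert (Hf2 : focal_dist g ^ 2 = semi_major g ^ 2 - semi_minor g ^ 2)
    by (apply pow2_sqrt; nra).
  assert (He : 0 <= focal_dist e) by apply sqrt_pos.
  assert (He2 : focal_dist e ^ 2 = semi_major e ^ 2 - semi_minor e ^ 2)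
    by (apply pow2_sqrt; nra).
  unfold confocal, focus1, focus2, vadd, vsub, vscale in Hc.
  unfold vopp, vscale.
  set (f := focal_dist g) in *; set (f' := focal_dist e) in *.
  destruct (axis g) as [g1 g2], (axis e) as [e1 e2].
  destruct (center g) as [c1 c2], (center e) as [d1 d2].
  cbn [fst snd] in *.
  assert (E : (f * g1 = f' * e1 /\ f * g2 = f' * e2 /\ c1 = d1 /\ c2 = d2) \/
              (f * g1 = - (f' * e1) /\ f * g2 = - (f' * e2) /\ c1 = d1 /\ c2 = d2)).
  { destruct Hc as [[H3 H4] | [H3 H4]]; injection H3 as H3 H3'; injection H4 as H4 H4';
      [left | right]; repeat split; lra. }
  assert (Eff : f = f').
  { assert (f ^ 2 = f' ^ 2).
    { transitivity ((f * g1) ^ 2 + (f * g2) ^ 2);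
        [transitivity (f ^ 2 * (g1 ^ 2 + g2 ^ 2)); [rewrite Ug |]; ring |].
      transitivity ((f' * e1) ^ 2 + (f' * e2) ^ 2);
        [| transitivity (f' ^ 2 * (e1 ^ 2 + e2 ^ 2)); [| rewrite Ue]; ring].
      destruct E as [(E1 & E2 & _) | (E1 & E2 & _)]; rewrite E1, E2; ring. }
    nra. }
  rewrite <- Eff in *.
  split; [| split].
  - destruct E as [(_ & _ & E1 & E2) | (_ & _ & E1 & E2)]; rewrite E1, E2; reflexivity.
  - destruct E as [(E1 & E2 & _) | (E1 & E2 & _)]; [left | right];
      f_equal; apply (Rmult_eq_reg_l f); lra.
  - lra.
Qed.

(** The gap [lam] between the squares of the semi-axes is the same for both
    axes; it is positive because the vertex of [g] on its major axis is inside
    [e]. *)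
Lemma confocal_form g e :
  confocal g e -> lies_inside g e -> semi_minor g < semi_major g ->
  exists lam, 0 < lam /\ forall X, ellipse_form e X =
    semi_major g ^ 2 / (semi_major g ^ 2 + lam) * coord_x g X ^ 2 +
    semi_minor g ^ 2 / (semi_minor g ^ 2 + lam) * coord_y g X ^ 2.
Proof.
  intros Hc Hin Hlt.
  destruct (confocal_center_axis g e Hc Hlt) as (Ec & Ea & Ef).
  pose proof (semi_minor_pos g) as Hb; pose proof (semi_major_pos g) as Ha.
  pose proof (semi_minor_pos e) as Hb'; pose proof (semi_major_pos e) as Ha'.
  assert (Hform : forall X, ellipse_form e X =
    semi_major g ^ 2 / semi_major e ^ 2 * coord_x g X ^ 2 +
    semi_minor g ^ 2 / semi_minor e ^ 2 * coord_y g X ^ 2).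
  { intro X; unfold ellipse_form, coord_x, coord_y, scaled_x, scaled_y.
    rewrite Ec; destruct Ea as [Ea | Ea]; rewrite Ea;
      unfold vopp, vscale, dot, rot90; simpl; field; lra. }
  exists (semi_major e ^ 2 - semi_major g ^ 2).
  split.
  - pose proof (axis_sq g) as U.
    set (P := vadd (center g) (vscale (semi_major g) (axis g))).
    assert (Hx : coord_x g P = 1).
    { unfold P, coord_x, scaled_x, dot, vsub, vadd, vscale; simpl.
      transitivity (fst (axis g) ^ 2 + snd (axis g) ^ 2); [field; lra | exact U]. }
    assert (Hy : coord_y g P = 0).
    { unfold P, coord_y, scaled_y, dot, vsub, vadd, vscale, rot90; simpl; field; lra. }
    assert (HP : inside_ellipse e P).
    { apply Hin; unfold on_ellipse; rewrite ellipse_form_coord, Hx, Hy; ring. }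
    unfold inside_ellipse in HP; rewrite Hform, Hx, Hy in HP.
    assert (0 < semi_major e ^ 2) by nra.
    assert (HQ : semi_major g ^ 2 / semi_major e ^ 2 < 1) by lra.
    apply (Rmult_lt_compat_r (semi_major e ^ 2)) in HQ; [| assumption].
    unfold Rdiv in HQ; rewrite Rmult_assoc, Rinv_l in HQ; lra.
  - intro X; rewrite Hform.
    replace (semi_major g ^ 2 + (semi_major e ^ 2 - semi_major g ^ 2))
      with (semi_major e ^ 2) by ring.
    replace (semi_minor g ^ 2 + (semi_major e ^ 2 - semi_major g ^ 2))
      with (semi_minor e ^ 2) by lra.
    reflexivity.
Qed.

Lemma norm_sq v : norm v ^ 2 = dot v v.
Proof. apply pow2_sqrt; unfold dot; nra. Qed.

Lemma norm_pos v : v <> zero -> 0 < norm v.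
Proof.
  intros H; apply sqrt_lt_R0; unfold dot.
  destruct v as [x y]; simpl.
  destruct (Req_dec_T x 0), (Req_dec_T y 0); subst; try nra.
  exfalso; apply H; reflexivity.
Qed.

(** The two angles are supplementary, so equality makes both of them right. *)
Lemma backtrack_perp v t :
  v <> zero -> t <> zero -> angle v t = angle v (vopp t) -> dot v t = 0.
Proof.
  intros Hv Ht H; unfold angle in H.
  pose proof (norm_pos v Hv) as Nv; pose proof (norm_pos t Ht) as Nt.
  assert (E1 : norm (vopp t) = norm t)
    by (unfold norm, vopp, vscale, dot; simpl; f_equal; ring).
  assert (E2 : dot v (vopp t) = - dot v t)
    by (unfold vopp, vscale, dot; simpl; ring).
  rewrite E1, E2 in H.
  set (q := dot v t / (norm v * norm t)) in *.
  replace (- dot v t / (norm v * norm t)) with (- q) in H by (unfold q; field; lra).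
  rewrite acos_opp in H.
  assert (Hq2 : dot v t = q * (norm v * norm t)) by (unfold q; field; lra).
  assert (CS : -1 <= q <= 1).
  { assert (q ^ 2 <= 1); [| nra].
    assert (0 < (norm v * norm t) ^ 2) by (apply pow_lt, Rmult_lt_0_compat; assumption).
    apply (Rmult_le_reg_r ((norm v * norm t) ^ 2)); [assumption |].
    rewrite <- Rpow_mult_distr, <- Hq2, Rpow_mult_distr, !norm_sq, Rmult_1_l.
    unfold dot; pose proof (pow2_ge_0 (fst v * snd t - snd v * fst t)); nra. }
  assert (Hq : q = 0).
  { rewrite <- (cos_acos q CS), <- cos_PI2; f_equal; lra. }
  rewrite Hq2, Hq; ring.
Qed.

(** * From billiard trajectories to orbits *)

(** Coming back along the same segment means hitting [e] perpendicularly, but a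
    normal of an ellipse is never tangent to a confocal ellipse inside it.  In
    coordinates, a tangent [c x + s y = 1] of [g] that is normal to [e] at
    [(x, y)] satisfies [(a^2 - b^2) c x = a^2 + lam], whereas [c^2 <= 1] and
    [a^2 x^2 <= a^2 + lam]. *)
Lemma no_backtrack g e lam A P :
  semi_minor g < semi_major g -> 0 < lam ->
  (forall X, ellipse_form e X =
    semi_major g ^ 2 / (semi_major g ^ 2 + lam) * coord_x g X ^ 2 +
    semi_minor g ^ 2 / (semi_minor g ^ 2 + lam) * coord_y g X ^ 2) ->
  A <> P -> on_ellipse e P -> line_tangent g A P -> ~ reflects e A P A.
Proof.
  intros Hlt Hlam Hform Hne HP Htan Hrefl.
  pose proof (semi_minor_pos g) as Hb.
  destruct (line_tangent_coord g A P Hne Htan) as (c & s & Hcs & HA & HPl).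
  assert (Hv : vsub A P <> zero).
  { intro E; apply Hne; destruct A as [a1 a2], P as [p1 p2];
      unfold vsub, zero in E; simpl in E; injection E as E1 E2; f_equal; lra. }
  unfold on_ellipse in HP; rewrite Hform in HP.
  assert (Hxy : coord_x g A - coord_x g P <> 0 \/ coord_y g A - coord_y g P <> 0).
  { destruct (Req_dec_T (coord_x g A) (coord_x g P)) as [E | E]; [| left; lra].
    destruct (Req_dec_T (coord_y g A) (coord_y g P)) as [E' | E']; [| right; lra].
    exfalso; apply Hne, (coord_inj g); congruence. }
  pose proof (dot_scaled g (vsub A P)) as Hdot.
  rewrite scaled_x_vsub, scaled_y_vsub in Hdot.
  set (a := semi_major g) in *; set (b := semi_minor g) in *.
  set (x := coord_x g P) in *; set (y := coord_y g P) in *.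
  set (d := coord_x g A - x) in *; set (d' := coord_y g A - y) in *.
  (* The tangent of [e] at [P]: the gradient of its form, turned by a right
     angle in the scaled coordinates. *)
  set (t := vadd (vscale (- (b / (b ^ 2 + lam)) * y * b * a) (axis g))
                 (vscale (a / (a ^ 2 + lam) * x * a * b) (rot90 (axis g)))).
  pose proof (axis_sq g) as U.
  assert (Hpa : 0 < a ^ 2 + lam) by nra. assert (Hpb : 0 < b ^ 2 + lam) by nra.
  assert (Tx : scaled_x g t = - (b ^ 2 / (b ^ 2 + lam)) * y).
  { transitivity (- (b ^ 2 / (b ^ 2 + lam)) * y * (fst (axis g) ^ 2 + snd (axis g) ^ 2));
      [| rewrite U; ring].
    unfold t, scaled_x, dot, vadd, vscale, rot90; simpl; fold a; field; lra. }
  assert (Ty : scaled_y g t = a ^ 2 / (a ^ 2 + lam) * x).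
  { transitivity (a ^ 2 / (a ^ 2 + lam) * x * (fst (axis g) ^ 2 + snd (axis g) ^ 2));
      [| rewrite U; ring].
    unfold t, scaled_y, dot, vadd, vscale, rot90; simpl; fold b; field; lra. }
  assert (Ht : t <> zero).
  { intro E.
    assert (E1 : scaled_x g t = 0) by (rewrite E; unfold scaled_x, dot, zero; simpl; field; fold a; lra).
    assert (E2 : scaled_y g t = 0) by (rewrite E; unfold scaled_y, dot, zero; simpl; field; fold b; lra).
    rewrite Tx in E1; rewrite Ty in E2.
    assert (H1 : 1 = b ^ 2 / (b ^ 2 + lam) * y * y + a ^ 2 / (a ^ 2 + lam) * x * x)
      by (rewrite <- HP; ring).
    rewrite E2 in H1. replace (b ^ 2 / (b ^ 2 + lam) * y) with 0 in H1 by lra. lra. }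
  assert (HD : dot (vsub A P) t = 0).
  { apply backtrack_perp; [exact Hv | exact Ht |].
    apply Hrefl, (tangent_dir_iff g e _ _ P t Hform).
    split; [exact Ht |].
    fold a b x y; rewrite Tx, Ty; ring. }
  rewrite Hdot, Tx, Ty in HD.
  (* In scaled coordinates the line [AP] has direction [(- s, c)]. *)
  assert (Hdir : c * d + s * d' = 0) by (unfold d, d'; lra).
  assert (Hr : d = - s * (c * d' - s * d) /\ d' = c * (c * d' - s * d)).
  { split.
    - transitivity (d * (c ^ 2 + s ^ 2)); [rewrite Hcs; ring |].
      transitivity (c * (c * d + s * d') - s * (c * d' - s * d)); [ring | rewrite Hdir; ring].
    - transitivity (d' * (c ^ 2 + s ^ 2)); [rewrite Hcs; ring |].
      transitivity (s * (c * d + s * d') + c * (c * d' - s * d)); [ring | rewrite Hdir; ring]. }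
  set (r := c * d' - s * d) in *.
  destruct Hr as [Ed Ed'].
  assert (Hr0 : r <> 0).
  { intro E; rewrite E in Ed, Ed'; destruct Hxy as [Hx | Hx]; apply Hx; lra. }
  assert (HE : (a ^ 2 + lam) * (s * y) + (b ^ 2 + lam) * (c * x) = 0).
  { apply (Rmult_eq_reg_l (r * (a ^ 2 * b ^ 2) / ((a ^ 2 + lam) * (b ^ 2 + lam)))).
    - rewrite Rmult_0_r, <- HD, Ed, Ed'; field; lra.
    - unfold Rdiv; repeat apply Rmult_integral_contrapositive_currified;
        try exact Hr0; try apply Rinv_neq_0_compat; nra. }
  assert (Hcx : (a ^ 2 - b ^ 2) * (c * x) = a ^ 2 + lam).
  { replace (s * y) with (1 - c * x) in HE by lra. lra. }
  assert (Hab : 0 < a ^ 2 - b ^ 2) by nra.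
  assert (Hx2 : a ^ 2 * x ^ 2 <= a ^ 2 + lam).
  { assert (0 <= b ^ 2 / (b ^ 2 + lam) * y ^ 2).
    { apply Rmult_le_pos; [apply Rlt_le, Rdiv_lt_0_compat; nra | apply pow2_ge_0]. }
    replace (a ^ 2 * x ^ 2) with ((a ^ 2 + lam) * (a ^ 2 / (a ^ 2 + lam) * x ^ 2))
      by (field; lra).
    nra. }
  assert (Hc2 : c ^ 2 <= 1) by (pose proof (pow2_ge_0 s); lra).
  (* These bounds give [(a^2 + lam)^2 <= a^2 (a^2 + lam)]. *)
  assert (H1 : (a ^ 2 + lam) ^ 2 <= (a ^ 2 - b ^ 2) ^ 2 * x ^ 2).
  { rewrite <- Hcx.
    replace (((a ^ 2 - b ^ 2) * (c * x)) ^ 2) with (c ^ 2 * ((a ^ 2 - b ^ 2) ^ 2 * x ^ 2)) by ring.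
    assert (0 <= (a ^ 2 - b ^ 2) ^ 2 * x ^ 2) by (apply Rmult_le_pos; apply pow2_ge_0).
    nra. }
  assert (H2 : (a ^ 2 - b ^ 2) ^ 2 * x ^ 2 <= a ^ 2 * (a ^ 2 * x ^ 2)).
  { assert ((a ^ 2 - b ^ 2) ^ 2 <= a ^ 2 * a ^ 2) by nra.
    pose proof (pow2_ge_0 x); nra. }
  nra.
Qed.

(** The sides are tangents of the inner ellipse, hence described by eccentric
    angles.  The law of reflection keeps two consecutive sides from lying on one
    line, so they are the two tangents from their common vertex. *)
Lemma billiard_angles E g n M lam :
  0 < lam ->
  (forall X, ellipse_form E X =
    semi_major g ^ 2 / (semi_major g ^ 2 + lam) * coord_x g X ^ 2 +
    semi_minor g ^ 2 / (semi_minor g ^ 2 + lam) * coord_y g X ^ 2) ->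
  semi_minor g < semi_major g -> billiard_ngon E n M -> circumscribes M g ->
  let K := semi_major g ^ 2 / (semi_major g ^ 2 + lam) in
  let L := semi_minor g ^ 2 / (semi_minor g ^ 2 + lam) in
  exists f : nat -> R,
    (orbit K L f \/ orbit K L (fun i => - f i)) /\
    forall i, cos (f i) * coord_x g (M i) + sin (f i) * coord_y g (M i) = 1 /\
      cos (f i) * coord_x g (M (S i)) + sin (f i) * coord_y g (M (S i)) = 1.
Proof.
  intros Hlam Hform Hlt (Hon & Hne & Hrefl & _) Htan K L.
  pose proof (ratio_bounds (semi_major g) lam (semi_major_pos g) Hlam) as HK; fold K in HK.
  pose proof (ratio_bounds (semi_minor g) lam (semi_minor_pos g) Hlam) as HL; fold L in HL.
  fold K L in Hform.
  destruct (functional_choice (fun i (w : R * R) => fst w ^ 2 + snd w ^ 2 = 1 /\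
    fst w * coord_x g (M i) + snd w * coord_y g (M i) = 1 /\
    fst w * coord_x g (M (S i)) + snd w * coord_y g (M (S i)) = 1)) as [w Hw].
  { intro i; destruct (line_tangent_coord g _ _ (Hne i) (Htan i)) as (c & s & H).
    exists (c, s); exact H. }
  set (x := fun i => coord_x g (M i)); set (y := fun i => coord_y g (M i)).
  assert (HC : forall i, K * x i ^ 2 + L * y i ^ 2 = 1).
  { intro i; unfold x, y; rewrite <- Hform; apply Hon. }
  assert (HD : forall i, (x i, y i) <> (x (S i), y (S i))).
  { intros i E'; apply (Hne i), (coord_inj g), E'. }
  destruct (poncelet_orbit K L HK HL x y (fun i => fst (w i)) (fun i => snd (w i)))
    as (f & Hf & Horb); try (intro i; apply Hw); auto.
  - intros i E'; injection E' as E1 E2.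
    destruct (Hw i) as (H1 & H2 & H3); destruct (Hw (S i)) as (H4 & H5 & H6).
    rewrite <- E1, <- E2 in H6.
    assert (Hback : M (S (S i)) = M i).
    { apply (coord_inj g).
      apply (conic_line_third K L HK HL (fst (w i)) (snd (w i)) (x i) (y i)
               (x (S i)) (y (S i)));
        solve [assumption | apply HC | apply HD]. }
    specialize (Hrefl i); rewrite Hback in Hrefl; revert Hrefl.
    apply (no_backtrack g E lam); auto.
  - exists f; split; [exact Horb |].
    intro i; destruct (Hf i) as [-> ->]; apply Hw.
Qed.

(** Half of the period advances the angle by [k PI].  If [k] were even, the
    polygon would already close up after [m] steps, against minimality; so [k]
    is odd, opposite sides are centrally symmetric, and half of [m] steps act as
    an odd power of [quarter]. *)
Lemma billiard_symmetries E g m M lam f :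
  let K := semi_major g ^ 2 / (semi_major g ^ 2 + lam) in
  let L := semi_minor g ^ 2 / (semi_minor g ^ 2 + lam) in
  0 < lam -> (0 < m)%nat -> billiard_ngon E (m + m) M ->
  orbit K L f \/ orbit K L (fun i => - f i) ->
  (forall i, cos (f i) * coord_x g (M i) + sin (f i) * coord_y g (M i) = 1 /\
      cos (f i) * coord_x g (M (S i)) + sin (f i) * coord_y g (M (S i)) = 1) ->
  (forall i, cos (f (i + m)%nat) = - cos (f i) /\ sin (f (i + m)%nat) = - sin (f i)) /\
  forall l, m = (l + l)%nat -> forall i,
    tangent_norm (semi_major g) (semi_minor g) (f i) *
    tangent_norm (semi_major g) (semi_minor g) (f (i + l)%nat) =
    semi_major g * semi_minor g.
Proof.
  intros K L Hlam Hm (_ & Hne & _ & Hper & Hmin) Horb Hinc.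
  pose proof (ratio_bounds (semi_major g) lam (semi_major_pos g) Hlam) as HK; fold K in HK.
  pose proof (ratio_bounds (semi_minor g) lam (semi_minor_pos g) Hlam) as HL; fold L in HL.
  assert (HneC : forall i, (coord_x g (M i), coord_y g (M i)) <>
                           (coord_x g (M (S i)), coord_y g (M (S i)))).
  { intros i E'; apply (Hne i), (coord_inj g), E'. }
  assert (Hf0 : cos (f (m + m)%nat) = cos (f 0%nat) /\ sin (f (m + m)%nat) = sin (f 0%nat)).
  { destruct (Hinc (m + m)%nat) as [I1 I2].
    pose proof (Hper 0%nat) as P0; pose proof (Hper 1%nat) as P1.
    rewrite Nat.add_0_l in P0; replace (1 + (m + m))%nat with (S (m + m)) in P1 by lia.
    rewrite P0 in I1; rewrite P1 in I2.
    destruct (Hinc 0%nat) as [J1 J2].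
    pose proof (incidence_unique _ _ _ _ _ _ _ _ (HneC 0%nat) I1 I2 J1 J2) as E'.
    injection E'; auto. }
  (* Mirroring keeps cosines and negates sines, so both orientations can be
     treated through one increasing orbit [h]. *)
  assert (G : exists h, orbit K L h /\
     (forall i, cos (h i) = cos (f i)) /\
     ((forall i, sin (h i) = sin (f i)) \/ (forall i, sin (h i) = - sin (f i)))).
  { destruct Horb as [H | H].
    - exists f; auto.
    - exists (fun i => - f i); split; [exact H |]; split.
      + intro; apply cos_neg.
      + right; intro; apply sin_neg. }
  destruct G as (h & Hh & Hc & Hs).
  destruct (orbit_half K L h m HK HL Hh) as [k Hk].
  { rewrite !Hc; apply Hf0. }
  { destruct Hf0; destruct Hs as [Hs | Hs]; rewrite !Hs; lra. }
  assert (Hcos : forall i, cos (f (i + m)%nat) = cos (IZR k * PI) * cos (f i)).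
  { intro i; rewrite <- !Hc, Hk; apply cos_add_IZR_PI. }
  assert (Hsin : forall i, sin (f (i + m)%nat) = cos (IZR k * PI) * sin (f i)).
  { intro i; pose proof (sin_add_IZR_PI (h i) k) as A; rewrite <- Hk in A.
    destruct Hs as [Hs | Hs]; rewrite !Hs in A; lra. }
  assert (Hodd : exists j, k = (2 * j + 1)%Z).
  { destruct (Z.Even_or_Odd k) as [[j Hj] | [j Hj]]; [exfalso | exists j; exact Hj].
    assert (E1 : cos (IZR k * PI) = 1).
    { rewrite Hj, mult_IZR. pose proof (cos_IZR_PI_sq j) as S2.
      replace (2 * IZR j * PI) with (2 * (IZR j * PI)) by ring.
      rewrite cos_2a_cos; lra. }
    assert (HMS : forall i, M (S i + m)%nat = M (S i)).
    { intro i.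
      destruct (Hinc (i + m)%nat) as [_ I1]; destruct (Hinc (S i + m)%nat) as [I2 _].
      rewrite Hcos, Hsin, E1, !Rmult_1_l in I1, I2.
      destruct (Hinc i) as [_ J1]; destruct (Hinc (S i)) as [J2 _].
      change (S (i + m)) with (S i + m)%nat in I1.
      apply (coord_inj g).
      apply (incidence_unique (cos (f i)) (sin (f i)) (cos (f (S i))) (sin (f (S i))));
        try lra.
      intro E'; injection E' as Ec Es.
      assert (Hz : sin (h (S i) - h i) = 0).
      { rewrite sin_minus, !Hc, Ec.
        destruct Hs as [Hs | Hs]; rewrite !Hs, Es; ring. }
      destruct (Hh i) as [B _].
      assert (0 < sin (h (S i) - h i)) by (apply sin_gt_0; lra).
      lra. }
    apply (Hmin m); [lia |].
    (* The vertex of index 0 is reached through its copy of index [m + m]. *)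
    intro i; destruct i as [| i]; [| apply HMS].
    destruct m as [| m']; [lia |].
    rewrite <- (Hper 0%nat), Nat.add_0_l, Nat.add_0_l.
    rewrite Nat.add_succ_l at 1.
    symmetry; apply (HMS m'). }
  destruct Hodd as [j Hj].
  assert (E1 : cos (IZR k * PI) = -1).
  { rewrite Hj, plus_IZR, mult_IZR. pose proof (cos_IZR_PI_sq j) as S2.
    replace ((2 * IZR j + 1) * PI) with (2 * (IZR j * PI) + PI) by ring.
    rewrite neg_cos, cos_2a_cos; lra. }
  split.
  - intro i; rewrite Hcos, Hsin, E1; split; ring.
  - intros l Hl i.
    assert (HT : forall i, tangent_norm (semi_major g) (semi_minor g) (f i) =
                           tangent_norm (semi_major g) (semi_minor g) (h i)).
    { intro r; unfold tangent_norm; rewrite Hc; f_equal.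
      destruct Hs as [Hs | Hs]; rewrite Hs; ring. }
    rewrite !HT.
    apply (orbit_quarter _ _ (semi_major_pos g) (semi_minor_pos g) lam Hlam h l j Hh).
    intro r; rewrite <- Hl, <- Hj; apply Hk.
Qed.

(** * Distances to the sides *)

(** In units of the semi-axes the gradient of [c x + s y - 1] is no longer of
    length 1; the denominator accounts for this. *)
Lemma dist_to_tangent g A B X c s :
  A <> B -> c ^ 2 + s ^ 2 = 1 ->
  c * coord_x g A + s * coord_y g A = 1 ->
  c * coord_x g B + s * coord_y g B = 1 ->
  dist_to_line X A B =
  semi_major g * semi_minor g * Rabs (c * coord_x g X + s * coord_y g X - 1)
  / sqrt (semi_major g ^ 2 * s ^ 2 + semi_minor g ^ 2 * c ^ 2).
Proof.
  intros Hne Hcs HA HB.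
  pose proof (semi_minor_pos g) as Hb; pose proof (semi_major_pos g) as Ha.
  unfold dist_to_line.
  set (u := vsub B A).
  set (w := vsub X (foot X A B)).
  assert (Hu : dot u u <> 0).
  { intro E; apply Hne; unfold u, dot, vsub in E; simpl in E.
    destruct (Rplus_sqr_eq_0 _ _ E); destruct A, B; simpl in *; f_equal; lra. }
  assert (Hwu : dot w u = 0).
  { unfold w, foot; fold u; set (k := dot (vsub X A) u / dot u u).
    transitivity (dot (vsub X A) u - k * dot u u);
      [unfold dot, vsub, vadd, vscale; simpl; ring | unfold k; field; exact Hu]. }
  assert (Hlw : c * scaled_x g w + s * scaled_y g w =
                c * coord_x g X + s * coord_y g X - 1).
  { unfold w, foot; fold u; set (k := dot (vsub X A) u / dot u u).
    rewrite scaled_x_vsub, scaled_y_vsub, coord_x_line, coord_y_line.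
    unfold u; rewrite scaled_x_vsub, scaled_y_vsub.
    rewrite <- HA.
    replace (c * coord_x g A + s * coord_y g A) with
      (c * coord_x g A + s * coord_y g A +
       k * ((c * coord_x g B + s * coord_y g B) - (c * coord_x g A + s * coord_y g A)))
      by (rewrite HA, HB; ring).
    ring. }
  assert (Hlu : c * scaled_x g u + s * scaled_y g u = 0).
  { unfold u; rewrite scaled_x_vsub, scaled_y_vsub; lra. }
  rewrite (dot_scaled g) in Hu, Hwu.
  pose proof (norm_sq w) as Hn; rewrite (dot_scaled g) in Hn.
  set (a := semi_major g) in *; set (b := semi_minor g) in *.
  set (h := c * coord_x g X + s * coord_y g X - 1) in *.
  set (p := scaled_x g u) in *; set (q := scaled_y g u) in *.
  set (x := scaled_x g w) in *; set (y := scaled_y g w) in *.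
  assert (Ep : p = - s * (c * q - s * p)).
  { transitivity (p * (c ^ 2 + s ^ 2)); [rewrite Hcs; ring |].
    transitivity (c * (c * p + s * q) - s * (c * q - s * p)); [ring | rewrite Hlu; ring]. }
  assert (Eq : q = c * (c * q - s * p)).
  { transitivity (q * (c ^ 2 + s ^ 2)); [rewrite Hcs; ring |].
    transitivity (s * (c * p + s * q) + c * (c * q - s * p)); [ring | rewrite Hlu; ring]. }
  set (r := c * q - s * p) in *.
  assert (Hr : r <> 0).
  { intro E; apply Hu; rewrite Ep, Eq, E; ring. }
  assert (Hperp : a ^ 2 * s * x = b ^ 2 * c * y).
  { apply (Rmult_eq_reg_l r); [| exact Hr]. rewrite Ep, Eq in Hwu; lra. }
  set (N2 := a ^ 2 * s ^ 2 + b ^ 2 * c ^ 2).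
  assert (HN2 : 0 < N2).
  { unfold N2; pose proof (pow2_ge_0 c); pose proof (pow2_ge_0 s).
    assert (0 < a ^ 2) by nra. assert (0 < b ^ 2) by nra.
    destruct (Rle_lt_dec (c ^ 2) (1 / 2)); nra. }
  assert (Hx : x * N2 = b ^ 2 * c * h).
  { rewrite <- Hlw. transitivity (s * (a ^ 2 * s * x) + b ^ 2 * c ^ 2 * x);
      [unfold N2; ring | rewrite Hperp; ring]. }
  assert (Hy : y * N2 = a ^ 2 * s * h).
  { rewrite <- Hlw. transitivity (a ^ 2 * s ^ 2 * y + c * (b ^ 2 * c * y));
      [unfold N2; ring | rewrite <- Hperp; ring]. }
  assert (HN : 0 < sqrt N2) by (apply sqrt_lt_R0, HN2).
  assert (HNs : sqrt N2 ^ 2 = N2) by (apply pow2_sqrt; lra).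
  apply Rsqr_inj.
  - apply sqrt_pos.
  - apply Rmult_le_pos; [| apply Rlt_le, Rinv_0_lt_compat, HN].
    apply Rmult_le_pos; [nra | apply Rabs_pos].
  - rewrite !Rsqr_pow2, Hn.
    transitivity ((a * b) ^ 2 * Rabs h ^ 2 / sqrt N2 ^ 2); [| field; lra].
    rewrite pow2_abs, HNs.
    apply (Rmult_eq_reg_r (N2 * N2)); [| nra].
    transitivity (a ^ 2 * (x * N2) ^ 2 + b ^ 2 * (y * N2) ^ 2); [ring |].
    rewrite Hx, Hy. unfold N2; field. unfold N2 in HN2; lra.
Qed.

Lemma prod_mult_const f h k N :
  (forall i, f i * h i = k) ->
  prod_f_R0 f N * prod_f_R0 h N = k ^ S N.
Proof.
  intros H; induction N as [| N IH]; [simpl; rewrite H; ring |].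
  change (k ^ S (S N)) with (k * k ^ S N).
  rewrite <- IH, <- (H (S N)); simpl; ring.
Qed.

Lemma prod_pairs f m k :
  (0 < m)%nat -> (forall i, f i * f (i + m)%nat = k) ->
  prod_f_R0 f (m + m - 1) = k ^ m.
Proof.
  intros Hm H.
  rewrite (prod_SO_split f (m + m - 1) (m - 1)) by lia.
  replace (m + m - 1 - (m - 1) - 1)%nat with (m - 1)%nat by lia.
  rewrite (prod_mult_const f _ k); [f_equal; lia |].
  intro i; rewrite <- (H i); do 2 f_equal; lia.
Qed.

Lemma coord_center g : coord_x g (center g) = 0 /\ coord_y g (center g) = 0.
Proof.
  unfold coord_x, coord_y, scaled_x, scaled_y, dot, vsub, rot90; simpl.
  unfold Rdiv; split; ring.
Qed.

Lemma coord_foci g :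
  coord_x g (focus1 g) = focal_dist g / semi_major g /\ coord_y g (focus1 g) = 0 /\
  coord_x g (focus2 g) = - (focal_dist g / semi_major g) /\ coord_y g (focus2 g) = 0.
Proof.
  pose proof (axis_sq g) as U.
  pose proof (semi_major_pos g); pose proof (semi_minor_pos g).
  set (k := focal_dist g / semi_major g).
  unfold coord_x, coord_y, scaled_x, scaled_y, focus1, focus2, dot, vadd, vsub, vscale,
    rot90; simpl.
  repeat split.
  - transitivity (k * (fst (axis g) ^ 2 + snd (axis g) ^ 2));
      [unfold k; field; lra | rewrite U; ring].
  - field; lra.
  - transitivity (- k * (fst (axis g) ^ 2 + snd (axis g) ^ 2));
      [unfold k; field; lra | rewrite U; ring].
  - field; lra.
Qed.

(** With [k] the eccentricity up to sign, this is the classical fact that the product of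
    the distances from the foci to a tangent is [b^2]; the second factor is the
    distance from the same focus to the opposite tangent. *)
Lemma focal_dist_pair a b k x :
  0 < b -> b <= a -> k ^ 2 = 1 - b ^ 2 / a ^ 2 ->
  a * b * Rabs (cos x * k - 1) / tangent_norm a b x *
  (a * b * Rabs (- cos x * k - 1) / tangent_norm a b x) = b ^ 2.
Proof.
  intros Hb Hab Hk.
  pose proof (tangent_norm_pos a b ltac:(lra) Hb x) as HN.
  pose proof (tangent_norm_sq a b x) as HN2.
  assert (HP : Rabs (cos x * k - 1) * Rabs (- cos x * k - 1) = 1 - cos x ^ 2 * k ^ 2).
  { rewrite <- Rabs_mult.
    replace ((cos x * k - 1) * (- cos x * k - 1)) with (1 - cos x ^ 2 * k ^ 2) by ring.
    apply Rabs_pos_eq.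
    assert (0 < b ^ 2 / a ^ 2) by (apply Rdiv_lt_0_compat; nra).
    pose proof (sin_sq_cos_sq x). pose proof (pow2_ge_0 (sin x)).
    pose proof (pow2_ge_0 (cos x)). pose proof (pow2_ge_0 k). nra. }
  transitivity ((a * b) ^ 2 * (Rabs (cos x * k - 1) * Rabs (- cos x * k - 1))
                / tangent_norm a b x ^ 2); [field; lra |].
  rewrite HP, Hk, HN2, sin_sq_cos_sq; field.
  rewrite sin_sq_cos_sq in HN2; split; nra.
Qed.

(** * The products of distances *)

Theorem theorem4p3 :
  forall (E gamma : ellipse) (n : nat),
    (3 <= n)%nat ->
    confocal gamma E ->
    lies_inside gamma E ->
    semi_minor gamma < semi_major gamma ->
    (Nat.Even n ->
       forall M : nat -> point,
         billiard_ngon E n M -> circumscribes M gamma ->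
         side_dist_prod n M (focus1 gamma) = semi_minor gamma ^ n /\
         side_dist_prod n M (focus2 gamma) = semi_minor gamma ^ n) /\
    (Nat.divide 4 n ->
       forall M : nat -> point,
         billiard_ngon E n M -> circumscribes M gamma ->
         side_dist_prod n M (center gamma) =
           (semi_major gamma * semi_minor gamma) ^ (n / 2)%nat).
Proof.
  intros E g n Hn Hconf Hin Hlt.
  destruct (confocal_form g E Hconf Hin Hlt) as (lam & Hlam & Hform).
  pose proof (semi_minor_pos g) as Hb; pose proof (semi_major_pos g) as Ha.
  assert (Hside : forall M f, billiard_ngon E n M ->
    (forall i, cos (f i) * coord_x g (M i) + sin (f i) * coord_y g (M i) = 1 /\
       cos (f i) * coord_x g (M (S i)) + sin (f i) * coord_y g (M (S i)) = 1) ->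
    forall X i, side_dist M X i = semi_major g * semi_minor g *
      Rabs (cos (f i) * coord_x g X + sin (f i) * coord_y g X - 1) /
      tangent_norm (semi_major g) (semi_minor g) (f i)).
  { intros M f (_ & Hne & _) Hinc X i; destruct (Hinc i) as [I1 I2].
    apply dist_to_tangent; auto.
    pose proof (sin_sq_cos_sq (f i)); lra. }
  split.
  - intros [m Hm] M HM Htan.
    assert (Em : n = (m + m)%nat) by lia.
    destruct (billiard_angles E g n M lam Hlam Hform Hlt HM Htan) as (f & Horb & Hinc).
    pose proof (Hside M f HM Hinc) as HS.
    rewrite Em in HM |- *.
    destruct (billiard_symmetries E g m M lam f Hlam ltac:(lia) HM Horb Hinc) as [Hsym _].
    destruct (coord_foci g) as (X1 & Y1 & X2 & Y2).
    assert (Hk : (focal_dist g / semi_major g) ^ 2 =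
                 1 - semi_minor g ^ 2 / semi_major g ^ 2).
    { unfold focal_dist.
      transitivity (sqrt (semi_major g ^ 2 - semi_minor g ^ 2) ^ 2 / semi_major g ^ 2);
        [field; lra |].
      rewrite pow2_sqrt by nra; field; lra. }
    set (k := focal_dist g / semi_major g) in *.
    assert (HT : forall i, tangent_norm (semi_major g) (semi_minor g) (f (i + m)%nat) =
                           tangent_norm (semi_major g) (semi_minor g) (f i)).
    { intro i; destruct (Hsym i) as [C S]; unfold tangent_norm; rewrite C, S; f_equal; ring. }
    assert (Hpow : semi_minor g ^ (m + m) = (semi_minor g ^ 2) ^ m)
      by (rewrite <- pow_mult; f_equal; lia).
    rewrite Hpow.
    split; apply prod_pairs; try lia; intro i; destruct (Hsym i) as [C S].
    + rewrite !HS, X1, Y1, C, S, HT, !Rmult_0_r, !Rplus_0_r.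
      apply focal_dist_pair; lra.
    + rewrite !HS, X2, Y2, C, S, HT, !Rmult_0_r, !Rplus_0_r.
      apply focal_dist_pair; lra.
  - intros [l Hl] M HM Htan.
    assert (Em : n = (l + l + (l + l))%nat) by lia.
    destruct (billiard_angles E g n M lam Hlam Hform Hlt HM Htan) as (f & Horb & Hinc).
    pose proof (Hside M f HM Hinc) as HS.
    rewrite Em in HM.
    destruct (billiard_symmetries E g (l + l) M lam f Hlam ltac:(lia) HM Horb Hinc)
      as [_ Hq].
    specialize (Hq l eq_refl).
    destruct (coord_center g) as [X0 Y0].
    assert (HO : forall i, side_dist M (center g) i * side_dist M (center g) (i + l) =
                           semi_major g * semi_minor g).
    { intro i; rewrite !HS, X0, Y0, !Rmult_0_r, Rplus_0_r, Rminus_0_l, Rabs_Ropp, Rabs_R1.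
      pose proof (tangent_norm_pos _ _ Ha Hb (f i)).
      pose proof (tangent_norm_pos _ _ Ha Hb (f (i + l)%nat)).
      transitivity ((semi_major g * semi_minor g) ^ 2 /
        (tangent_norm (semi_major g) (semi_minor g) (f i) *
         tangent_norm (semi_major g) (semi_minor g) (f (i + l)%nat))); [field; lra |].
      rewrite Hq; field; lra. }
    assert (E2 : (n / 2 = l + l)%nat).
    { rewrite Em; replace (l + l + (l + l))%nat with ((l + l) * 2)%nat by lia.
      apply Nat.div_mul; lia. }
    rewrite E2, Em; unfold side_dist_prod.
    (* Sides [i] and [i + l] are paired within each half of the polygon. *)
    rewrite (prod_SO_split _ _ (l + l - 1)) by lia.
    replace (l + l + (l + l) - 1 - (l + l - 1) - 1)%nat with (l + l - 1)%nat by lia.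
    rewrite pow_add; f_equal; apply prod_pairs; try lia; [exact HO |].
    intro i.
    replace (l + l - 1 + 1 + (i + l))%nat with (l + l - 1 + 1 + i + l)%nat by lia.
    apply HO.
Qed.
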